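(* Let $a\in\mathbb{R}$ and $r>0$ be fixed, and let $I$ denote the bounded interval $I=[a-r,a+r]$. For a fixed integer $N\in\mathbb{N}$, consider a function $\varphi\in\mathcal{A}_0^{d-1}(I,N,2^{d+3}r)$. There exists a finite decomposition \[ I=\bigcup_{j=1}^{M_{N}}I_j \] into almost disjoint intervals such that $\varphi^{(d)}$ is single-signed on each $I_j$, and there exist positive constants $c_j, C_j, K_j>0$, centres $a_j\in\mathbb{R}\setminus I_j$, and integers $k_j\leq 2N$ such that for each $t\in I_j$, \[ c_j|a_j-t|^{k_j}\leq |\varphi^{(d)}(t)|\leq C_j|a_j-t|^{k_j}, \] and for each $(t_1,\ldots,t_d)\in I_j^d$, \[ |J_{\Gamma}(t_1,\ldots,t_d)|\geq K_j\prod_{l=1}^d|\varphi^{(d)}(t_l)|^{\frac{1}{d}}\prod_{k>l}|t_k-t_l|. \]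
   Context: Here $d$ is the dimension of the ambient space $\mathbb{R}^d$, $\gamma:I\to\mathbb{R}^d$ is the simple curve $\gamma(t)=(t,t^2,\ldots,t^{d-1},\varphi(t))$, $\Gamma(t_1,\ldots,t_d)=\sum_{i=1}^d\gamma(t_i)$, and $J_\Gamma$ is the Jacobian determinant of $\Gamma:I^d\to\mathbb{R}^d$. The last product is over all pairs $1\le l<k\le d$. $M_N$ denotes the (finite) number of intervals in the decomposition. Intervals are almost disjoint if they overlap at most at endpoints. Frequency function: for a holomorphic function $u$, not identically zero, with power series $u(z)=\sum_{n=0}^\infty c_n(z-z_0)^n$ around $z_0\in\mathbb{C}$, the frequency on the disc $D(z_0,R)=\{z\in\mathbb{C}:|z-z_0|<R\}$ is \[ N_u(z_0,R)=2\,\frac{\sum_{n=1}^\infty n|c_n|^2R^{2n}}{\sum_{k=0}^\infty |c_k|^2R^{2k}} . \] Function classes: for a compact interval $I=[a-r,a+r]$, $N\in\mathbb{N}$ and $R>r$, $\mathcal{A}(I,N,R)$ is the set of functions $\varphi:I\to\mathbb{R}$ for which there exists $\Phi$ holomorphic on $D(a,R)$ with $\Phi|_I=\varphi$ and $N_\Phi(a,R)\le N$, and \[ \mathcal{A}^{d-1}_0(I,N,R)=\{\varphi\in\mathcal{A}(I,N,R):\varphi(a)=\varphi'(a)=\cdots=\varphi^{(d-1)}(a)=0\}. \]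
   Formalization: The centre a_j is required to lie outside I_j except that it may be an endpoint of I_j at which φ^(d) vanishes; as printed the claim fails when φ^(d) has a zero in I, e.g. φ(t)=(t-a)^{d+1} with N≥2d+2. *)

(* Defs.v *)
From HB Require Import structures.
From mathcomp Require Import all_boot all_order all_algebra.
From mathcomp Require Import complex.
From mathcomp Require Import all_classical all_reals all_analysis.

Set Implicit Arguments.
Unset Strict Implicit.
Unset Printing Implicit Defensive.

Import Order.TTheory GRing.Theory Num.Theory.
Import numFieldNormedType.Exports ComplexField.Normc.

Local Open Scope classical_set_scope.
Local Open Scope complex_scope.
Local Open Scope ring_scope.

Section frequency.
Variable R : realType.
Implicit Types (u : R[i] -> R[i]) (z : R[i]) (c : nat -> R[i]) (rho : R).

Definition disc (z0 : R[i]) rho : set R[i] := [set z | normc (z - z0) < rho].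

(* [derivable _ z 1] over the field [R[i]] is complex differentiability. *)
Definition holomorphic_on (D : set R[i]) u :=
  forall z, D z -> derivable (u : R[i]^o -> R[i]^o) z 1.

Definition power_series_on (z0 : R[i]) rho u c :=
  forall z, disc z0 rho z ->
    series (fun n => c n * (z - z0) ^+ n : R[i]^o) @ \oo --> (u z : R[i]^o).

Definition freq_num c rho : R^nat :=
  series (fun n => n%:R * normc (c n) ^+ 2 * rho ^+ (2 * n)).

Definition freq_den c rho : R^nat :=
  series (fun n => normc (c n) ^+ 2 * rho ^+ (2 * n)).

(* Only meaningful when both series converge and [c] is not zero. *)
Definition frequency c rho : R :=
  2 * (limn (freq_num c rho) / limn (freq_den c rho)).

(* A function holomorphic on an open disc may have divergent series in its
   frequency on that disc. Then the frequency is infinite (or oo/oo) and is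
   not bounded by N, whence the two convergence requirements. *)
Definition frequency_le u (z0 : R[i]) rho (N : R) :=
  (exists2 z, disc z0 rho z & u z != 0) /\
  exists c, [/\ power_series_on z0 rho u c,
                cvgn (freq_num c rho), cvgn (freq_den c rho) &
                frequency c rho <= N].

End frequency.

Section curve.
Variable R : realType.
Implicit Types (I : set R) (f phi : R -> R) (d : nat).

(* The derivative at [t] of the restriction of [f] to [I]: it is one-sided at
   the endpoints of an interval and ignores the values of [f] outside [I]. *)
Definition derive_within I f (t : R) : R :=
  lim ((f s - f t) / (s - t) @[s --> within I t^']).

Definition deriven_within I (n : nat) f : R -> R := iter n (derive_within I) f.

Definition centered_itv (a r : R) : set R := `[a - r, a + r]%classic.

Definition class_A (a r : R) (N : nat) (rho : R) : set (R -> R) :=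
  [set phi | exists Phi : R[i] -> R[i],
    [/\ holomorphic_on (disc a%:C rho) Phi,
        forall t, centered_itv a r t -> Phi t%:C = (phi t)%:C &
        frequency_le Phi a%:C rho N%:R]].

(* [class_A0 d] asks for the vanishing of the derivatives of order < d; it is
   the class usually indexed by the largest such order, d - 1. *)
Definition class_A0 d (a r : R) (N : nat) (rho : R) : set (R -> R) :=
  [set phi | class_A a r N rho phi /\
    forall k, (k < d)%N -> deriven_within (centered_itv a r) k phi a = 0].

Definition simple_curve d phi (t : R) : 'rV[R]_d :=
  \row_(i < d) (if i.+1 == d then phi t else t ^+ i.+1).

Definition Gamma d phi (t : 'rV[R]_d) : 'rV[R]_d :=
  \sum_(i < d) simple_curve d phi (t 0 i).

Definition set_coord d (t : 'rV[R]_d) (j : 'I_d) (s : R) : 'rV[R]_d :=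
  \row_l (if l == j then s else t 0 l).

Definition partial_within I d (F : 'rV[R]_d -> R) (j : 'I_d) (t : 'rV[R]_d) : R :=
  derive_within I (fun s => F (set_coord t j s)) (t 0 j).

Definition jacobian_det I d (F : 'rV[R]_d -> 'rV[R]_d) (t : 'rV[R]_d) : R :=
  \det (\matrix_(i, j) partial_within I (fun u => F u 0 i) j t).

Definition single_signed_on I f :=
  (forall t, I t -> 0 <= f t) \/ (forall t, I t -> f t <= 0).

Definition itv_decomposition I (M : nat) (x y : 'I_M -> R) :=
  [/\ forall j, x j < y j,
      I = \bigcup_(j in [set: 'I_M]) `[x j, y j]%classic &
      forall i j, i != j ->
        `[x i, y i]%classic `&` `[x j, y j]%classic `<=` [set x i; y i]].

End curve.

(* Main.v *)
Require Import Defs.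
From HB Require Import structures.
From mathcomp Require Import all_boot all_order all_algebra.
From mathcomp Require Import complex.
From mathcomp Require Import all_classical all_reals all_analysis.
From mathcomp Require Import ring lra zify.

Set Implicit Arguments.
Unset Strict Implicit.
Unset Printing Implicit Defensive.

Import Order.TTheory GRing.Theory Num.Theory.
Import numFieldNormedType.Exports.

Local Open Scope classical_set_scope.
Local Open Scope ring_scope.

(** The Jacobian matrix has the rows 1, 2 t, ..., (d-1) t^(d-2), phi'(t), so by
    Lagrange interpolation its determinant is, up to the factor (d-1)!, the
    Vandermonde determinant times the divided difference of phi' at the nodes
    t_1, ..., t_d ([det_power_rows]).  What has to be bounded from below is
    therefore this divided difference, which by the mean value theorem is a
    value of phi^(d) divided by (d-1)!.  The point where that value is taken
    may however be close to a zero of phi^(d), so the mean value theorem is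
    used for a comparison instead.  If phi^(d) keeps its sign and
    c |t - p|^m <= |phi^(d)(t)| on an interval on one side of p, then the
    divided difference of phi' dominates that of the multiple of
    (t - p)^(m+d-1) whose derivative of order d-1 is c |t - p|^m up to sign.
    The divided difference of the latter is the complete homogeneous symmetric
    polynomial of degree m in the t_l - p; it contains each monomial
    (t_l - p)^m, hence is at least each of them ([divdiff_exp_ge]) and at least
    their geometric mean.  This is [divdiff_ge_power_weight].

    It remains to cut I into intervals, their number depending on N only, which
    meet the zeros of phi^(d) in at most one point, an endpoint, and to
    bound the multiplicities by 2 N.  Both follow once phi^(d) has at most 2 N
    zeros in I, counted with multiplicity ([frequency_roots]).  This is seen
    on Taylor coefficients, with the energies sum_n b_n^2 s^(2n), the mean
    squares on circles.  Removing from a power series a root z with |z| <= r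
    divides the energy at radius s > r by at least (s - r)^2, and that at
    radius r by at most (2 r)^2 ([energy_quotient_ge], [energy_quotient_le]);
    thus each root forces the energy to grow between the two radii by the
    factor ((s - r) / (2 r))^2 ([factor_roots]).  On the other hand the
    frequency is the average of 2 n for the weights b_n^2 rho^(2n), and by
    convexity a frequency at most N limits the growth of the energy between r
    and rho to (rho / r)^N ([frequency_energy_ge]).  As phi vanishes to order d
    at a, this growth bound passes to phi^(d) with a radius s < rho
    ([energy_diffs_le], [energy_diffs_ge]).  For rho = 2^(d+3) r and
    s = 3 2^d r the two bounds are incompatible with more than 2 N roots.

    The power series is real: the imaginary parts of its coefficients define a
    power series that vanishes on I ([class_A_real_coefficients]). *)

(** * Divided differences *)

Section divided_differences.
Variable F : fieldType.
Implicit Types (s : seq F) (f g : F -> F) (p q : {poly F}).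

(** The divided difference of f at the nodes s.  The symmetric formula is used
    rather than the recursive one because the nodes come in no particular
    order, and because it makes removing any one node equally easy. *)
Definition divdiff s f : F :=
  \sum_(x <- s) f x / \prod_(y <- s | y != x) (x - y).

Definition interpolant s f : {poly F} :=
  \sum_(x <- s) (f x / \prod_(y <- s | y != x) (x - y)) *:
                \prod_(y <- s | y != x) ('X - y%:P).

Lemma prod_sub_neq0 s (x : F) : \prod_(y <- s | y != x) (x - y) != 0.
Proof.
rewrite prodf_seq_neq0; apply/allP => y _; apply/implyP => yx.
by rewrite subr_eq0 eq_sym.
Qed.

Lemma count_neq s (x : F) : uniq s -> x \in s ->
  size [seq y <- s | y != x] = (size s).-1.
Proof. by move=> us xs; rewrite -rem_filter// size_rem. Qed.

Lemma size_node_poly s (x : F) : uniq s -> x \in s ->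
  size (\prod_(y <- s | y != x) ('X - y%:P)) = size s.
Proof.
move=> us xs; rewrite -big_filter size_prod_XsubC count_neq//.
by rewrite prednK//; case: s xs {us}.
Qed.

Lemma size_interpolant s f : uniq s -> (size (interpolant s f) <= size s)%N.
Proof.
move=> us; rewrite /interpolant big_seq_cond.
apply: (big_ind (fun p : {poly F} => size p <= size s)%N).
- by rewrite size_poly0.
- by move=> p q hp hq; rewrite (leq_trans (size_polyD _ _))// geq_max hp.
- move=> x /andP[xs _]; rewrite (leq_trans (size_scale_leq _ _))//.
  by rewrite size_node_poly.
Qed.

Lemma horner_interpolant s f (x : F) : uniq s -> x \in s -> (interpolant s f).[x] = f x.
Proof.
move=> us xs; rewrite /interpolant horner_sum (bigD1_seq x)//= [X in _ + X]big1 ?addr0.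
  rewrite hornerZ horner_prod.
  rewrite [X in _ / _ * X](eq_bigr (fun y => x - y)); last first.
    by move=> y _; rewrite hornerXsubC.
  by rewrite divfK// prod_sub_neq0.
move=> y yx; rewrite hornerZ horner_prod -[X in _ * X]big_filter.
rewrite [X in _ * X](bigD1_seq x)/=.
- by rewrite hornerXsubC subrr mul0r mulr0.
- by rewrite mem_filter eq_sym yx.
- by rewrite filter_uniq.
Qed.

Lemma coef_interpolant s f : uniq s -> (interpolant s f)`_(size s).-1 = divdiff s f.
Proof.
move=> us; rewrite /interpolant /divdiff coef_sum big_seq_cond [RHS]big_seq_cond.
apply: eq_bigr => x /andP[xs _]; rewrite coefZ.
rewrite -[X in _`_X.-1](size_node_poly us xs) -[X in _ * X]/(lead_coef _).
by rewrite -big_filter (monicP (monic_prod_XsubC _ _ _)) mulr1.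
Qed.

Lemma eq_divdiff s f g : {in s, f =1 g} -> divdiff s f = divdiff s g.
Proof.
move=> fg; rewrite /divdiff big_seq_cond [RHS]big_seq_cond.
by apply: eq_bigr => x /andP[/fg->].
Qed.

Lemma divdiff_perm s1 s2 f : perm_eq s1 s2 -> divdiff s1 f = divdiff s2 f.
Proof.
move=> s12; rewrite /divdiff (perm_big _ s12); apply: eq_bigr => x _.
by congr (_ / _); exact: perm_big.
Qed.

Lemma divdiffZ s f (a : F) : divdiff s (fun x => a * f x) = a * divdiff s f.
Proof. by rewrite /divdiff mulr_sumr; apply: eq_bigr => x _; rewrite mulrA. Qed.

Lemma divdiffB s f g :
  divdiff s (fun x => f x - g x) = divdiff s f - divdiff s g.
Proof. by rewrite /divdiff -sumrB; apply: eq_bigr => x _; rewrite mulrBl. Qed.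

(** The interpolant of a polynomial of degree less than the number of nodes is
    the polynomial itself. *)
Lemma divdiff_horner s p : uniq s -> (size p <= size s)%N ->
  divdiff s (horner p) = p`_(size s).-1.
Proof.
move=> us ps; rewrite -coef_interpolant//.
suff -> : interpolant s (horner p) = p by [].
apply/eqP; rewrite -subr_eq0; apply: contraT => nz.
have /(max_poly_roots nz)/(_ us) : all (root (interpolant s (horner p) - p)) s.
  apply/allP => x xs; rewrite rootE hornerD hornerN horner_interpolant//.
  by rewrite subrr.
rewrite ltnNge (leq_trans (size_polyD _ _))// size_polyN geq_max ps.
by rewrite size_interpolant.
Qed.

(** The factor x - p is (x - x0) + (x0 - p), and x - x0 cancels the
    denominators that come from the node x0. *)
Lemma divdiff_cons_mul (x0 p : F) s f : uniq (x0 :: s) ->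
  divdiff (x0 :: s) (fun x => (x - p) * f x) =
  divdiff s f + (x0 - p) * divdiff (x0 :: s) f.
Proof.
move=> /= /andP[x0s us].
have -> : divdiff s f = divdiff (x0 :: s) (fun x => (x - x0) * f x).
  rewrite /divdiff big_cons subrr !mul0r add0r big_seq_cond [RHS]big_seq_cond.
  apply: eq_bigr => x /andP[xs _].
  have xx0 : x0 != x by apply: contraNneq x0s => ->.
  rewrite big_cons xx0 invfM.
  have nz : x - x0 != 0 by rewrite subr_eq0 eq_sym.
  by rewrite [(x - x0) * f x]mulrC mulrA mulfK.
rewrite -divdiffZ /divdiff -big_split /=; apply: eq_bigr => x _.
by rewrite -mulrDl; congr (_ / _); ring.
Qed.

(** In the columns t_j, the last row takes the same values as the interpolant of
    f, hence is a combination of the powers of the t_j.  The matrix is thus a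
    lower triangular matrix times a Vandermonde matrix, and the last diagonal
    entry of the triangular factor is the leading coefficient of the
    interpolant. *)
Lemma det_power_rows n (w : nat -> F) (f : F -> F) (t : 'rV[F]_n.+1) :
  injective (t 0) ->
  \det (\matrix_(i < n.+1, j < n.+1)
          (if i == n :> nat then f (t 0 j) else w i * t 0 j ^+ i)) =
  (\prod_(i < n) w i) * divdiff [seq t 0 j | j <- enum 'I_n.+1] f *
  \prod_(i < n.+1) \prod_(j < n.+1 | (i < j)%N) (t 0 j - t 0 i).
Proof.
move=> tI; set s := [seq _ | _ <- _].
have us : uniq s by rewrite map_inj_uniq// enum_uniq.
have szs : size s = n.+1 by rewrite size_map size_enum_ord.
pose p := interpolant s f.
pose E : 'M[F]_n.+1 := \matrix_(i, k)
  (if i == n :> nat then p`_k else w i *+ (i == k)).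
have -> : \matrix_(i < n.+1, j < n.+1)
          (if i == n :> nat then f (t 0 j) else w i * t 0 j ^+ i) =
   E *m Vandermonde n.+1 t.
  apply/matrixP => i j; rewrite !mxE; under eq_bigr do rewrite !mxE.
  case: ifPn => _.
    have ps : (size p <= n.+1)%N by rewrite -szs size_interpolant.
    rewrite -(horner_coef_wide _ ps) horner_interpolant//.
    by apply/mapP; exists j => //; rewrite mem_enum.
  rewrite (bigD1 i)//= eqxx mulr1n big1 ?addr0// => k ki.
  by rewrite eq_sym (negbTE ki) mulr0n mul0r.
rewrite det_mulmx det_Vandermonde; congr (_ * _).
rewrite det_trig; last first.
  apply/is_trig_mxP => i j ij; rewrite mxE ifN ?(ltn_eqF ij) -?val_eqE/= ?(ltn_eqF ij)//.
  by rewrite neq_ltn (leq_trans ij)// -ltnS.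
rewrite big_ord_recr/= mxE eqxx; congr (_ * _).
  apply: eq_bigr => i _; rewrite mxE/= eqxx mulr1n ifN//.
  by rewrite neq_ltn ltn_ord.
have := coef_interpolant f us; rewrite szs => <-.
by rewrite eqxx.
Qed.

End divided_differences.

Section mean_value.
Variable R : realType.
Implicit Types (D : nat -> R -> R) (x y : R) (s : seq R).

(** The list s' interlaces c :: s; keeping it sorted allows the theorem of Rolle
    to be iterated. *)
Lemma Rolle_path D (c : R) s :
  (forall t, c <= t <= last c s -> is_derive t 1 (D 0%N) (D 1%N t)) ->
  path <%R c s -> all (fun t => D 0%N t == 0) (c :: s) ->
  exists s', [/\ size s' = size s, path <%R c s',
    all (fun t => t < last c s) s' & all (fun t => D 1%N t == 0) s'].
Proof.
elim: s c => [|e s IH] c/= dD; first by exists [::].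
move=> /andP[ce es] /and3P[/eqP Dc De Ds].
have le_e : e <= last e s.
  have : all (>= e) (e :: s).
    rewrite /= lexx/=; apply: (order_path_min le_trans).
    by apply: sub_path es => ? ? /ltW.
  by move/allP; apply; exact: mem_last.
have [|||s' [szs' es' ls' Ds']] := IH e => //.
- move=> t /andP[et tl]; apply: dD; rewrite tl (le_trans (ltW ce))//.
- by rewrite /= De.
have [|||z] := @Rolle R (D 0%N) c e ce.
- move=> t; rewrite in_itv/= => /andP[ct te].
  have [] // : is_derive t 1 (D 0%N) (D 1%N t).
  by apply: dD; rewrite ltW//= (le_trans (ltW te)).
- apply: derivable_within_continuous => t; rewrite in_itv/= => /andP[ct te].
  have [] // : is_derive t 1 (D 0%N) (D 1%N t).
  by apply: dD; rewrite ct (le_trans te).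
- by rewrite Dc (eqP De).
rewrite in_itv/= => /andP[cz ze] Dz.
exists (z :: s'); split => /=.
- by rewrite szs'.
- by rewrite cz/= (path_le lt_trans ze).
- by rewrite ls' (lt_le_trans ze).
- rewrite Ds' andbT; have dDz : is_derive z 1 (D 0%N) (D 1%N z).
    by apply: dD; rewrite (ltW cz)/= (le_trans (ltW ze)).
  by rewrite -(@derive_val _ _ _ _ _ _ _ dDz) (@derive_val _ _ _ _ _ _ _ Dz).
Qed.

Lemma iter_Rolle n D x y s :
  (forall k t, x <= t <= y -> is_derive t 1 (D k) (D k.+1 t)) ->
  size s = n.+1 -> sorted <%R s ->
  {in s, forall t, x <= t <= y /\ D 0%N t = 0} ->
  exists2 z, x <= z <= y & D n z = 0.
Proof.
elim: n D s => [|n IH] D [//|c s] dD /= [szs] cs sxy.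
  by have [cxy Dc0] := sxy c (mem_head _ _); exists c.
have inxy t : t \in c :: s -> x <= t <= y by move=> /sxy[].
have lxy := inxy _ (mem_last c s).
have cxy := inxy _ (mem_head c s).
have [|||s' [sz' cs' ls' D's']] := @Rolle_path D c s => //.
- move=> t /andP[ct tl]; apply: dD.
  case/andP: cxy => xc _; case/andP: lxy => _ ly.
  by rewrite (le_trans xc)//= (le_trans tl).
- by apply/allP => t /sxy[_ /eqP].
apply: (IH (fun k => D k.+1) s') => //.
- by rewrite sz'.
- exact: path_sorted cs'.
move=> t ts'; split; last by apply/eqP; exact: (allP D's').
have ct : c < t by have /allP/(_ _ ts') := order_path_min lt_trans cs'.
case/andP: cxy => xc _; case/andP: lxy => _ ly.
by rewrite (le_trans xc (ltW ct))/= (le_trans _ ly)// ltW// (allP ls').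
Qed.

(** D 0 minus its interpolant vanishes at n + 1 nodes, so its n-th derivative
    vanishes somewhere; that of the interpolant is the constant n! times the
    divided difference. *)
Lemma divdiff_mean_value n D x y s :
  (forall k t, x <= t <= y -> is_derive t 1 (D k) (D k.+1 t)) ->
  size s = n.+1 -> uniq s -> {in s, forall t, x <= t <= y} ->
  exists2 z, x <= z <= y & D n z = n`!%:R * divdiff s (D 0%N).
Proof.
move=> dD szs us sxy; set p := interpolant s (D 0%N).
have [|||| z zxy] := @iter_Rolle n (fun k t => D k t - p^`(k).[t]) x y (sort <=%R s).
- move=> k t txy; have := dD k _ txy => dDk.
  rewrite derivnS; exact: is_deriveB.
- by rewrite size_sort.
- by rewrite sort_lt_sorted.
- move=> t; rewrite mem_sort => ts; split; first exact: sxy.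
  by rewrite derivn0 horner_interpolant// subrr.
move=> /eqP; rewrite subr_eq0 => /eqP Dz; exists z => //; rewrite Dz.
have sp : (size p <= n.+1)%N by rewrite -szs size_interpolant.
have -> : p^`(n) = (n`!%:R * p`_n)%:P.
  apply/polyP => i; rewrite coef_derivn coefC.
  case: i => [|i]; first by rewrite addn0 ffactnn mulr_natl.
  by rewrite nth_default ?mul0rn// (leq_trans sp)// addnS ltnS leq_addr.
by rewrite hornerC -coef_interpolant// szs.
Qed.

Lemma divdiff_ge0 n D x y s :
  (forall k t, x <= t <= y -> is_derive t 1 (D k) (D k.+1 t)) ->
  size s = n.+1 -> uniq s -> {in s, forall t, x <= t <= y} ->
  (forall t, x <= t <= y -> 0 <= D n t) -> 0 <= divdiff s (D 0%N).
Proof.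
move=> dD szs us sxy Dn0; have [z zxy Dz] := divdiff_mean_value dD szs us sxy.
by have := Dn0 _ zxy; rewrite Dz pmulr_rge0// ltr0n fact_gt0.
Qed.

(** For nonnegative t - p (the case e = 1), the divided difference is the complete
    homogeneous symmetric polynomial of degree k in the t - p, one of whose
    monomials is (t - p)^k.  The proof splits off the node t with
    [divdiff_cons_mul]: the part without t is nonnegative by induction on the
    number of nodes, and the other one is t - p times the case k - 1.  The sign
    e = -1 covers nodes on the left of p. *)
Lemma divdiff_exp_ge (e p : R) s n k : size s = n.+1 -> uniq s ->
  {in s, forall t, 0 <= e * (t - p)} ->
  {in s, forall t, (e * (t - p)) ^+ k <=
                   e ^+ k * divdiff s (fun t => (t - p) ^+ (k + n))}.
Proof.
elim: n k s => [|n IHn] k s szs us sp.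
  case: s szs {us} sp => [//|c [|//]] _ sp t; rewrite inE => /eqP ->.
  by rewrite /divdiff !big_seq1 big_cons big_nil eqxx divr1 addn0 exprMn.
elim: k => [|k IHk] t ts.
  rewrite !expr0 mul1r add0n.
  rewrite (@eq_divdiff _ _ _ (horner (('X - p%:P) ^+ n.+1))); last first.
    by move=> u _ /=; rewrite !hornerE.
  have szX : size (('X - p%:P) ^+ n.+1) = n.+2 by rewrite size_exp_XsubC.
  rewrite divdiff_horner ?szX ?szs//=.
  rewrite -[X in _`_X]/(n.+2.-1) -szX -/(lead_coef _).
  by rewrite (monicP (monic_exp _ (monicXsubC _))).
have := ts => /perm_to_rem st; rewrite (divdiff_perm _ st).
have us' : uniq (t :: rem t s) by rewrite -(perm_uniq st).
have szr : size (rem t s) = n.+1 by rewrite size_rem// szs.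
rewrite (@eq_divdiff _ _ _ (fun u => (u - p) * (u - p) ^+ (k + n.+1))); last first.
  by move=> u _; rewrite addSn exprS.
(* The first summand has order k.+1 over the n.+1 remaining nodes. *)
rewrite divdiff_cons_mul// -(divdiff_perm _ st) [_ ^+ _ * _]mulrDr.
rewrite [leLHS]exprS -[leLHS]add0r lerD//.
  case: (rem t s) szr us' st => [//|c s'] sz' us' st.
  have := @IHn k.+1 (c :: s') sz' _ _ c (mem_head _ _); rewrite addSn addnS => h.
  apply: le_trans (h _ _).
  - by rewrite exprn_ge0// sp// (perm_mem st) !inE eqxx orbT.
  - by case/andP: us'.
  - by move=> u us''; apply: sp; rewrite (perm_mem st) inE us'' orbT.
have -> q : e ^+ k.+1 * ((t - p) * q) = (e * (t - p)) * (e ^+ k * q).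
  by rewrite exprS; ring.
by rewrite ler_wpM2l ?IHk// sp.
Qed.

End mean_value.

(** * Power series *)

Section series_facts.
Variable R : realType.
Implicit Types (u v : R^nat) (l : R).

Lemma cvg_series_cons u l :
  series (fun n => u n.+1) @ \oo --> l -> series u @ \oo --> u 0%N + l.
Proof.
move=> ul; rewrite -(cvg_shiftS (series u)).
rewrite (_ : [sequence _]_n = (fun n => u 0%N + series (fun n => u n.+1) n)).
  by apply: cvgD => //; exact: cvg_cst.
by apply/funext => n /=; rewrite /series/= big_nat_recl.
Qed.

Lemma series_behead u : cvgn (series u) ->
  cvgn (series (fun n => u n.+1)) /\
  limn (series u) = u 0%N + limn (series (fun n => u n.+1)).
Proof.
move=> cu; have su : series (fun n => u n.+1) @ \oo --> limn (series u) - u 0%N.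
  rewrite (_ : series (fun n => u n.+1) =
               (fun n => [sequence series u n.+1]_n n - u 0%N)).
    by apply: cvgB; [rewrite cvg_shiftS|exact: cvg_cst].
  by apply/funext => n; rewrite /series/= big_nat_recl// addrC addKr.
by split; [exact: cvgP su|rewrite (cvg_lim _ su)// addrC subrK].
Qed.

Lemma series_drop u d : (forall k, (k < d)%N -> u k = 0) -> cvgn (series u) ->
  cvgn (series (fun n => u (n + d)%N)) /\
  limn (series (fun n => u (n + d)%N)) = limn (series u).
Proof.
elim: d u => [|d IH] u u0 cu.
  by under eq_fun do rewrite addn0.
have [cu' lu] := series_behead cu.
have [|] := IH (fun n => u n.+1) _ cu'; first by move=> k kd; exact: u0.
by under eq_fun do rewrite -addnS; rewrite lu u0// add0r.
Qed.

Lemma cvg_series_scale (k : R) u : cvgn (series u) ->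
  cvgn (series (fun n => k * u n)) /\
  limn (series (fun n => k * u n)) = k * limn (series u).
Proof. by move=> cu; split; [exact: is_cvg_seriesZ|exact: lim_seriesZ]. Qed.

Lemma lim_series_ge0 u : (forall n, 0 <= u n) -> cvgn (series u) ->
  forall m, u m <= limn (series u).
Proof.
move=> u0 cu m; apply: (@le_trans _ _ (series u m.+1)).
  rewrite /series/= big_nat_recr//= lerDr sumr_ge0//.
exact: (nondecreasing_cvgn_le (nondecreasing_series (fun n _ _ => u0 n))).
Qed.

End series_facts.

Section power_series.
Variable R : realType.
Implicit Types (b f g : R^nat) (rho s t z : R).

(** The radius of convergence is at least rho.  Boundedness of the terms, rather
    than convergence, is what passes easily to derivatives and quotients. *)
Definition radius_ge rho b :=
  forall s, 0 <= s < rho -> exists A, forall n, `|b n| * s ^+ n <= A.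

Definition psum b t : R := limn (pseries b t).

(** The explicit bound serves to control, uniformly in the order of the tail,
    the tails of a power series that give the coefficients of a quotient. *)
Lemma psum_geometric b s t A : 0 < s -> `|t| < s ->
  (forall n, `|b n| * s ^+ n <= A) ->
  cvgn (series (fun n => `|b n| * `|t| ^+ n)) /\
  `|psum b t| <= A / (1 - `|t| / s).
Proof.
move=> s0 ts bA.
have A0 : 0 <= A by apply: le_trans (bA 0%N); rewrite mulr_ge0// exprn_ge0// ltW.
have q0 : 0 <= `|t| / s by rewrite divr_ge0// ltW.
have q1 : `|(`|t| / s)| < 1 by rewrite ger0_norm// ltr_pdivrMr// mul1r.
have le_geo n : `|b n| * `|t| ^+ n <= geometric A (`|t| / s) n.
  have -> : `|b n| * `|t| ^+ n = (`|b n| * s ^+ n) * (`|t| / s) ^+ n.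
    by rewrite expr_div_n; field; rewrite expf_neq0// gt_eqF.
  by rewrite /geometric/= ler_wpM2r// exprn_ge0.
have cgeo := is_cvg_geometric_series (a := A) q1.
have cN : cvgn (series (fun n => `|b n| * `|t| ^+ n)).
  apply: series_le_cvg le_geo cgeo => n; first by rewrite mulr_ge0// exprn_ge0.
  by rewrite /geometric/= mulr_ge0// exprn_ge0.
split=> //.
have eN : [normed series (fun n => b n * t ^+ n)] = series (fun n => `|b n| * `|t| ^+ n).
  by apply/funext => n; apply: eq_bigr => i _; rewrite /= normrM normrX.
rewrite /psum /pseries; apply: (le_trans (lim_series_norm _)); rewrite eN//.
rewrite -(cvg_lim _ (cvg_geometric_series (a := A) q1))//.
exact: lim_series_le.
Qed.

Lemma is_cvg_pseries_norm rho b t : radius_ge rho b -> `|t| < rho ->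
  cvgn (series (fun n => `|b n| * `|t| ^+ n)).
Proof.
move=> br tr; pose s := (`|t| + rho) / 2.
have t0 : 0 <= `|t| := normr_ge0 t.
have [|A bA] := br s; first by rewrite /s; lra.
by have [|||] := @psum_geometric b s t A; rewrite /s; try lra.
Qed.

Lemma is_cvg_pseries rho b t : radius_ge rho b -> `|t| < rho ->
  cvgn (pseries b t).
Proof.
move=> br tr; apply: normed_cvg.
rewrite (_ : [normed series _] = series (fun n => `|b n| * `|t| ^+ n)).
  exact: is_cvg_pseries_norm br tr.
by apply/funext => n; apply: eq_bigr => i _; rewrite /= normrM normrX.
Qed.

(** The factor n + 1 that comes with differentiation is absorbed by an
    arbitrarily small decrease of the radius. *)
Lemma natr_geometric_le (q : R) n : 0 <= q <= 1 -> n.+1%:R * q ^+ n * (1 - q) <= 1.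
Proof.
move=> /andP[q0 q1].
suff : n.+1%:R * q ^+ n * (1 - q) <= 1 - q ^+ n.+1.
  by move/le_trans; apply; rewrite lerBlDr lerDl exprn_ge0.
elim: n => [|n IH]; first by rewrite expr0 !expr1 !mul1r.
have qn : 0 <= q ^+ n by rewrite exprn_ge0.
have qS1 : q * q ^+ n <= 1 by rewrite -exprS exprn_ile1.
have h1 : 0 <= (1 - q) * (1 - q * q ^+ n) by rewrite mulr_ge0// subr_ge0.
have := ler_wpM2l q0 IH; rewrite -[n.+2%:R]natr1 !exprS.
set N := n.+1%:R; set X := q ^+ n in qS1 h1 *; lra.
Qed.

Lemma radius_ge_diffs rho b : radius_ge rho b -> radius_ge rho (pseries_diffs b).
Proof.
move=> br s /andP[s0 sr].
have [s' /andP[ss' s'r]] : exists s', s < s' < rho by exists ((s + rho) / 2); lra.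
have s'0 : 0 < s' by lra.
have [|A bA] := br s'; first by lra.
have A0 : 0 <= A by apply: le_trans (bA 0%N); rewrite mulr_ge0// exprn_ge0// ltW.
exists (A / s' * (1 - s / s')^-1) => n.
have q0 : 0 <= s / s' by rewrite divr_ge0// ltW.
have q1 : s / s' < 1 by rewrite ltr_pdivrMr// mul1r.
have -> : `|pseries_diffs b n| * s ^+ n =
   (`|b n.+1| * s' ^+ n.+1) / s' * (n.+1%:R * (s / s') ^+ n).
  rewrite /pseries_diffs normrM normr_nat.
  rewrite [(s / s') ^+ n]expr_div_n [s' ^+ n.+1]exprSr; field.
  by rewrite ?expf_neq0 ?lt0r_neq0.
rewrite ler_pM//.
- rewrite divr_ge0 ?mulr_ge0 ?exprn_ge0 ?(ltW s'0)//.
- by rewrite mulr_ge0// exprn_ge0.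
- by rewrite ler_pM2r ?invr_gt0.
by rewrite -[leRHS]mul1r ler_pdivlMr ?subr_gt0// natr_geometric_le// q0 ltW.
Qed.

Lemma is_derive_psum rho b t : radius_ge rho b -> `|t| < rho ->
  is_derive t 1 (psum b) (psum (pseries_diffs b) t).
Proof.
move=> br tr; have t0 : 0 <= `|t| := normr_ge0 t.
have [s /andP[ts sr]] : exists s, `|t| < s < rho by exists ((`|t| + rho) / 2); lra.
have sE : `|s| = s by rewrite ger0_norm// (le_trans t0) ?ltW.
have s0 : `|s| < rho by rewrite sE.
have b1 := radius_ge_diffs br; have b2 := radius_ge_diffs b1.
apply: (@pseries_snd_diffs _ b s); try exact: is_cvg_pseries s0.
by rewrite sE.
Qed.

Lemma iter_diffsE b d n :
  iter d (@pseries_diffs R) b n = ((n + d) ^_ d)%:R * b (n + d)%N.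
Proof.
elim: d n => [|d IH] n /=; first by rewrite addn0 ffactn0 mul1r.
by rewrite /pseries_diffs IH mulrA -natrM -addSnnS ffactnSr addnK mulnC.
Qed.

Lemma radius_ge_iter_diffs rho b d : radius_ge rho b ->
  radius_ge rho (iter d (@pseries_diffs R) b).
Proof. by move=> br; elim: d => //= d; exact: radius_ge_diffs. Qed.

Lemma psum_behead rho b t : radius_ge rho b -> `|t| < rho ->
  psum b t = b 0%N + t * psum (fun n => b n.+1) t.
Proof.
move=> br tr; have cb := is_cvg_pseries br tr.
have [cb' lb] := series_behead cb; rewrite [LHS]lb /= ?expr0 mulr1; congr (_ + _).
have [->|t0] := eqVneq t 0.
  rewrite mul0r (_ : series _ = fun=> 0) ?lim_cst//.
  by apply/funext => n; rewrite /series/= big1// => i _; rewrite exprS mul0r mulr0.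
have [_ h] := cvg_series_scale t^-1 cb'.
rewrite -[LHS](mulVKf t0) -h; congr (t * limn (series _)).
by apply/funext => n /=; rewrite exprS mulrCA mulKf.
Qed.

Lemma psum0 b : psum b 0 = b 0%N.
Proof.
rewrite /psum (_ : pseries b 0 = series (fun n => if n == 0%N then b 0%N else 0)).
  have := @cvg_series_cons R (fun n => if n == 0%N then b 0%N else 0) 0.
  rewrite addr0 /= => /(_ _)/cvg_lim; apply => //.
  rewrite (_ : series _ = fun=> 0); first exact: cvg_cst.
  by apply/funext => n; rewrite /series/= big1.
apply/funext => n; apply: eq_bigr => -[|i] _ /=; first by rewrite mulr1.
by rewrite exprS mul0r mulr0.
Qed.

Lemma radius_ge_tail rho f k : radius_ge rho f ->
  radius_ge rho (fun n => f (n + k)%N).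
Proof.
move=> fr s /andP[s0 sr].
have [s' /andP[ss' s'r]] : exists s', s < s' < rho by exists ((s + rho) / 2); lra.
have s'0 : 0 < s' by lra.
have [|A fA] := fr s'; first by lra.
exists (A / s' ^+ k) => n; rewrite ler_pdivlMr ?exprn_gt0//.
apply: le_trans (fA (n + k)%N); rewrite exprD mulrA.
by rewrite ler_wpM2r ?exprn_ge0 ?(ltW s'0)// ler_wpM2l// lerXn2r// ?nnegrE ltW.
Qed.

(** The power series with coefficients f is (X - z) times the one with
    coefficients g. *)
Definition is_quotient z f g :=
  f 0%N = - (z * g 0%N) /\ forall n, f n.+1 = g n - z * g n.+1.

(** The coefficient of index n of the quotient is the tail f_(n+1) + f_(n+2) z + ...
    evaluated at z. *)
Lemma root_quotient rho z f : `|z| < rho -> radius_ge rho f -> psum f z = 0 ->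
  exists2 g, radius_ge rho g & is_quotient z f g.
Proof.
move=> zr fr fz.
pose g n := psum (fun k => f (k + n.+1)%N) z; exists g.
  move=> s /andP[s0 sr].
  have z0 : 0 <= `|z| := normr_ge0 z.
  have [s' [ss' zs' s'r]] : exists s', [/\ s < s', `|z| < s' & s' < rho].
    by exists ((Num.max s `|z| + rho) / 2); case: (leP s `|z|) => ?; split; lra.
  have s'0 : 0 < s' by lra.
  have [|A fA] := fr s'; first lra.
  exists (A / s' / (1 - `|z| / s')) => n.
  have q1 : 0 < 1 - `|z| / s' by rewrite subr_gt0 ltr_pdivrMr// mul1r.
  have [|_] := @psum_geometric (fun k => f (k + n.+1)%N) s' z (A / s' ^+ n.+1) s'0 zs'.
    move=> k; rewrite ler_pdivlMr ?exprn_gt0// -mulrA -exprD; exact: fA.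
  rewrite -/(g n) => gn.
  apply: (@le_trans _ _ (`|g n| * s' ^+ n)).
    by rewrite ler_wpM2l// lerXn2r// ?nnegrE// ltW.
  apply: le_trans (ler_wpM2r _ gn) _; first by rewrite exprn_ge0// ltW.
  rewrite le_eqVlt; apply/orP; left; apply/eqP.
  by rewrite exprS; field; rewrite !gt_eqF ?exprn_gt0// subr_gt0.
have gS n : g n = f n.+1 + z * g n.+1.
  rewrite /g (psum_behead (radius_ge_tail _ fr) zr) add0n.
  by congr (_ + _ * psum _ _); apply/funext => k; rewrite addSnnS.
split; last by move=> n; rewrite gS addrK.
apply/eqP; rewrite -addr_eq0 -fz (psum_behead fr zr) /g.
rewrite (_ : (fun k => f (k + 1)%N) = fun k => f k.+1)//.
by apply/funext => k; rewrite addn1.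
Qed.

Lemma psum_quotient rho z f g t : `|z| < rho -> radius_ge rho f ->
  radius_ge rho g -> is_quotient z f g -> `|t| < rho ->
  psum f t = (t - z) * psum g t.
Proof.
move=> zr fr gr [f0 fS] tr.
have g1 : radius_ge rho (fun n => g n.+1).
  by under eq_fun do rewrite -addn1; exact: radius_ge_tail.
rewrite (psum_behead fr tr) f0.
have -> : psum (fun n => f n.+1) t = psum g t - z * psum (fun n => g n.+1) t.
  have [c1 l1] := cvg_series_scale z (is_cvg_pseries g1 tr).
  rewrite /psum /pseries -[in RHS]l1 -lim_seriesB//; last exact: is_cvg_pseries gr tr.
  congr (limn (series _)); apply/funext => n.
  by rewrite /= fS mulrBl; congr (_ - _); rewrite -mulrA.
rewrite [in RHS]mulrBl; have := psum_behead gr tr; set G := psum g t.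
set G1 := psum _ t => ->; ring.
Qed.

End power_series.

(** * Energies of coefficient sequences *)

Section energy.
Variable R : realType.
Implicit Types (b f g : R^nat) (rho r s t z : R).

(** By Parseval, the mean square of the power series on the circle of radius s. *)
Definition energy b s : R := limn (series (fun n => b n ^+ 2 * s ^+ (2 * n))).

Lemma energy_term_ge0 b s n : 0 <= b n ^+ 2 * s ^+ (2 * n).
Proof. by rewrite mulr_ge0 ?sqr_ge0// exprM exprn_ge0 ?sqr_ge0. Qed.

Lemma is_cvg_energy rho b s : radius_ge rho b -> 0 <= s < rho ->
  cvgn (series (fun n => b n ^+ 2 * s ^+ (2 * n))).
Proof.
move=> br /[dup] srho /andP[s0 sr].
have [A bA] := br s srho.
have As : `|s| < rho by rewrite ger0_norm.
have [cA _] := cvg_series_scale A (is_cvg_pseries_norm br As).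
apply: series_le_cvg cA => n; first exact: energy_term_ge0.
  apply: mulr_ge0; last by rewrite mulr_ge0 ?exprn_ge0.
  by apply: le_trans (bA 0%N); rewrite mulr_ge0.
rewrite (ger0_norm s0) mul2n -addnn exprD -real_normK ?num_real// expr2.
by rewrite mulrACA ler_wpM2r// mulr_ge0// exprn_ge0.
Qed.

Lemma energy_ge_term rho b s m : radius_ge rho b -> 0 <= s < rho ->
  b m ^+ 2 * s ^+ (2 * m) <= energy b s.
Proof.
move=> br sr; apply: (lim_series_ge0 _ (is_cvg_energy br sr)) => n.
exact: energy_term_ge0.
Qed.

Lemma energy_gt0 rho b s m : radius_ge rho b -> 0 < s < rho -> b m != 0 ->
  0 < energy b s.
Proof.
move=> br /andP[s0 sr] bm; apply: (@lt_le_trans _ _ (b m ^+ 2 * s ^+ (2 * m))).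
  by apply: mulr_gt0; [rewrite exprn_even_gt0|exact: exprn_gt0].
by apply: energy_ge_term br _; rewrite ltW.
Qed.

Lemma le_energy rho b r s : radius_ge rho b -> 0 <= r -> r <= s -> s < rho ->
  energy b r <= energy b s.
Proof.
move=> br r0 rs sr; have s0 := le_trans r0 rs.
apply: lim_series_le => [||n].
- by apply: is_cvg_energy br _; rewrite r0 (le_lt_trans rs).
- by apply: is_cvg_energy br _; rewrite s0.
by rewrite ler_wpM2l ?sqr_ge0// lerXn2r.
Qed.

Lemma sqrB_le_split r s x y : 0 < r -> 0 < s ->
  (x - y) ^+ 2 <= (1 + r / s) * x ^+ 2 + (1 + s / r) * y ^+ 2.
Proof.
move=> r0 s0; rewrite -subr_ge0.
rewrite (_ : _ - _ = (r * x + s * y) ^+ 2 / (r * s)).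
  by rewrite divr_ge0 ?sqr_ge0// ltW// mulr_gt0.
by field; rewrite !gt_eqF.
Qed.

Lemma sqrB_ge_split r s x y : 0 < r -> 0 < s ->
  (1 - r / s) * x ^+ 2 - (s / r - 1) * y ^+ 2 <= (x - y) ^+ 2.
Proof.
move=> r0 s0; rewrite -subr_ge0.
rewrite (_ : _ - _ = (r * x - s * y) ^+ 2 / (r * s)).
  by rewrite divr_ge0 ?sqr_ge0// ltW// mulr_gt0.
by field; rewrite !gt_eqF.
Qed.

Section quotient.
Variables (rho r s z : R) (f g : R^nat).
Hypotheses (r0 : 0 < r) (s0 : 0 < s) (sr : s < rho) (zr : `|z| <= r).
Hypotheses (fr : radius_ge rho f) (gr : radius_ge rho g).
Hypothesis fg : is_quotient z f g.

Let u n := if n is m.+1 then g m * s ^+ n else 0.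
Let v n := z * g n * s ^+ n.

Let term_f n : f n ^+ 2 * s ^+ (2 * n) = (u n - v n) ^+ 2.
Proof.
have [f0 fS] := fg.
have -> : s ^+ (2 * n) = (s ^+ n) ^+ 2 by rewrite mulnC exprM.
rewrite -exprMn; congr (_ ^+ 2); rewrite /u /v.
by case: n => [|n]; rewrite ?f0 ?fS ?expr0; ring.
Qed.

Let sr' : 0 <= s < rho. Proof. by rewrite ltW. Qed.

Let sum_u : series (fun n => u n ^+ 2) @ \oo --> s ^+ 2 * energy g s.
Proof.
rewrite -[X in _ --> X]add0r -[X in X + _](expr0n R 2).
apply: (@cvg_series_cons R (fun n => u n ^+ 2)).
have [cg lg] := cvg_series_scale (s ^+ 2) (is_cvg_energy gr sr').
rewrite -lg; move: cg.
rewrite (_ : (fun n => u n.+1 ^+ 2) =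
             fun n => s ^+ 2 * (g n ^+ 2 * s ^+ (2 * n)))//.
apply/funext => n; rewrite /u /=.
have -> : s ^+ (2 * n) = (s ^+ n) ^+ 2 by rewrite mulnC exprM.
by rewrite [s ^+ n.+1]exprS; ring.
Qed.

Let le_v n : v n ^+ 2 <= r ^+ 2 * (g n ^+ 2 * s ^+ (2 * n)).
Proof.
have -> : v n ^+ 2 = z ^+ 2 * (g n ^+ 2 * s ^+ (2 * n)).
  have -> : s ^+ (2 * n) = (s ^+ n) ^+ 2 by rewrite mulnC exprM.
  by rewrite /v; ring.
rewrite ler_wpM2r ?energy_term_ge0// -real_normK ?num_real//.
by rewrite lerXn2r// nnegrE ltW.
Qed.

Let sum_rv := cvg_series_scale (r ^+ 2) (is_cvg_energy gr sr').

(** On the circle of radius s one has |X - z| <= s + r.  In terms of coefficients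
    this is the triangle inequality for the two sequences u and v of which f is
    the difference; it is applied term by term, with the weights r / s and s / r that
    give the sharp constant after summation. *)
Lemma energy_quotient_le : energy f s <= (s + r) ^+ 2 * energy g s.
Proof.
have [c1 l1] := cvg_series_scale (1 + r / s) (cvgP _ sum_u).
have [cv lv] := sum_rv.
have [c2 l2] := cvg_series_scale (1 + s / r) cv.
rewrite (cvg_lim _ sum_u)// in l1; rewrite lv in l2.
have -> : (s + r) ^+ 2 * energy g s =
    (1 + r / s) * (s ^+ 2 * energy g s) +
    (1 + s / r) * (r ^+ 2 * energy g s).
  by field; rewrite !gt_eqF.
rewrite -l1 -l2 -lim_seriesD//; apply: lim_series_le.
- exact: is_cvg_energy fr sr'.
- exact: is_cvg_seriesD.
move=> n; rewrite term_f; apply: le_trans (sqrB_le_split _ _ r0 s0) _.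
by rewrite lerD2l ler_wpM2l// addr_ge0// divr_ge0// ltW.
Qed.

Lemma energy_quotient_ge : r <= s -> (s - r) ^+ 2 * energy g s <= energy f s.
Proof.
move=> rs.
have [c1 l1] := cvg_series_scale (1 - r / s) (cvgP _ sum_u).
have [cv lv] := sum_rv.
have [c2 l2] := cvg_series_scale (s / r - 1) cv.
rewrite (cvg_lim _ sum_u)// in l1; rewrite lv in l2.
have -> : (s - r) ^+ 2 * energy g s =
    (1 - r / s) * (s ^+ 2 * energy g s) -
    (s / r - 1) * (r ^+ 2 * energy g s).
  by field; rewrite !gt_eqF.
rewrite -l1 -l2 -lim_seriesB//; apply: lim_series_le.
- exact: is_cvg_seriesB.
- exact: is_cvg_energy fr sr'.
move=> n; rewrite term_f; apply: le_trans (sqrB_ge_split _ _ r0 s0).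
by rewrite lerD2l lerN2 ler_wpM2l// subr_ge0 ler_pdivlMr// mul1r.
Qed.

End quotient.

(** Each root removed costs one factor ((s - r) / (r + r))^2 of the ratio of the
    energies at s and r.  The ratio cannot fall below 1, so the process stops. *)
Lemma factor_roots rho r s n f :
  0 < r -> r < s -> s < rho -> radius_ge rho f -> 0 < energy f r ->
  energy f s < ((s - r) / (r + r)) ^+ (2 * n) * energy f r ->
  exists zs g, [/\ (size zs < n)%N, radius_ge rho g,
    forall t, `|t| < rho -> psum f t = \prod_(z <- zs) (t - z) * psum g t &
    forall t, `|t| <= r -> psum g t != 0].
Proof.
move=> r0 rs sr; have s0 := lt_trans r0 rs; have rr := lt_trans rs sr.
elim: n f => [|n IH] f fr Ef0 Efs.
  by move: Efs; rewrite mul1r ltNge (le_energy fr)// ltW.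
have [[z /andP[zr /eqP fz]]|nz] := pselect (exists z, (`|z| <= r) && (psum f z == 0)).
  have zrho := le_lt_trans zr rr.
  have [g gr fg] := root_quotient zrho fr fz.
  have Ele := energy_quotient_le r0 r0 rr zr fr gr fg.
  have Ege := energy_quotient_ge r0 s0 sr zr fr gr fg (ltW rs).
  have Eg0 : 0 < energy g r.
    have := lt_le_trans Ef0 Ele.
    by rewrite pmulr_rgt0// exprn_gt0// addr_gt0.
  have [|zs [h [szs hr gh hn]]] := IH g gr Eg0.
    rewrite -(ltr_pM2l (x := (s - r) ^+ 2)) ?exprn_gt0 ?subr_gt0//.
    apply: le_lt_trans Ege (lt_le_trans Efs _).
    apply: le_trans (ler_wpM2l _ Ele) _.
      by rewrite exprn_ge0// divr_ge0// ?subr_ge0 ltW// addr_gt0.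
    rewrite mulnS exprD; set q := (_ / _) ^+ (2 * n).
    rewrite le_eqVlt; apply/orP; left; apply/eqP.
    rewrite expr_div_n; field; rewrite gt_eqF//. by rewrite addr_gt0.
  exists (z :: zs), h; split => // t tr.
  by rewrite big_cons (psum_quotient zrho fr gr fg tr) gh// mulrA.
exists [::], f; split=> // [t|t tr]; first by rewrite big_nil mul1r.
by apply/negP => ft; apply: nz; exists t; rewrite tr.
Qed.

End energy.

(** * The frequency bounds the number of roots *)

Section frequency_bounds.
Variable R : realType.
Implicit Types (b f g : R^nat) (rho r s t z : R).

(** This is Jensen's inequality for the convex function x |-> (r / rho)^x: under
    the weights b_n^2 rho^(2n) the mean of 2 n is the frequency, at most N.  It
    is proved by summing the tangent line inequality at x = N. *)
Lemma frequency_energy_ge b rho r (N : nat) : 0 < r -> r < rho ->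
  cvgn (series (fun n => n%:R * b n ^+ 2 * rho ^+ (2 * n))) ->
  cvgn (series (fun n => b n ^+ 2 * rho ^+ (2 * n))) ->
  2 * limn (series (fun n => n%:R * b n ^+ 2 * rho ^+ (2 * n))) <=
    N%:R * energy b rho ->
  radius_ge rho b ->
  (r / rho) ^+ N * energy b rho <= energy b r.
Proof.
move=> r0 rr cnum cden le_num br.
have rho0 : 0 < rho by exact: lt_trans rr.
set q := r / rho; have q0 : 0 < q by rewrite divr_gt0.
have q1 : q <= 1 by rewrite ler_pdivrMr// mul1r ltW.
have lnq : ln q <= 0 by rewrite ln_le0.
have qE n : q ^+ n = expR (n%:R * ln q) by rewrite expRM_natl lnK.
have [c1 l1] := cvg_series_scale (q ^+ N * ln q * 2) cnum.
have [c2 l2] := cvg_series_scale (q ^+ N * (1 - ln q * N%:R)) cden.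
have cr : cvgn (series (fun n => b n ^+ 2 * r ^+ (2 * n))).
  by apply: is_cvg_energy br _; rewrite ltW.
have := lim_series_le (is_cvg_seriesD c1 c2) cr.
rewrite lim_seriesD// l1 l2 -/(energy b rho) -/(energy b r) => h.
apply: le_trans (h _).
  rewrite -subr_ge0; set A := limn _ in le_num *; set W := energy b rho in le_num *.
  have -> : q ^+ N * ln q * 2 * A + q ^+ N * (1 - ln q * N%:R) * W - q ^+ N * W =
    q ^+ N * ((- ln q) * (N%:R * W - 2 * A)) by ring.
  by rewrite mulr_ge0 ?exprn_ge0 ?(ltW q0)// mulr_ge0 ?oppr_ge0// subr_ge0.
move=> n /=.
have -> : r ^+ (2 * n) = q ^+ (2 * n) * rho ^+ (2 * n).
  by rewrite -exprMn divfK// gt_eqF.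
have bern : q ^+ N * (1 + ((2 * n)%:R - N%:R) * ln q) <= q ^+ (2 * n).
  have -> : q ^+ (2 * n) = q ^+ N * expR (((2 * n)%:R - N%:R) * ln q).
    by rewrite !qE -expRD; congr expR; ring.
  by rewrite ler_wpM2l ?exprn_ge0 ?(ltW q0)// expR_ge1Dx.
set w := b n ^+ 2 * rho ^+ (2 * n).
apply: le_trans (_ : q ^+ N * (1 + ((2 * n)%:R - N%:R) * ln q) * w <= _).
  rewrite natrM le_eqVlt; apply/orP; left; apply/eqP.
  by rewrite fctE -[n%:R * _ * _]mulrA -/w; set Q := q ^+ N; ring.
rewrite [leRHS]mulrCA ler_wpM2r// energy_term_ge0//.
Qed.

Lemma energy_diffs_ge b rho r d : 0 < r -> r < rho -> radius_ge rho b ->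
  (forall k, (k < d)%N -> b k = 0) ->
  d`!%:R ^+ 2 * energy b r <= r ^+ (2 * d) * energy (iter d (@pseries_diffs R) b) r.
Proof.
move=> r0 rr br b0; have rr' : 0 <= r < rho by rewrite ltW.
have cb := is_cvg_energy br rr'.
have [cb' lb] := series_drop (d := d) (u := fun n => b n ^+ 2 * r ^+ (2 * n))
  ltac:(by move=> k kd /=; rewrite b0// expr0n mul0r) cb.
have [c1 l1] := cvg_series_scale (d`!%:R ^+ 2) cb'.
have cd := is_cvg_energy (radius_ge_iter_diffs d br) rr'.
have [c2 l2] := cvg_series_scale (r ^+ (2 * d)) cd.
rewrite /energy -lb -l1 -l2; apply: lim_series_le => // n.
rewrite iter_diffsE.
have -> : d`!%:R ^+ 2 * (b (n + d)%N ^+ 2 * r ^+ (2 * (n + d))) =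
    r ^+ (2 * d) * ((d`!%:R * b (n + d)%N) ^+ 2 * r ^+ (2 * n)).
  by rewrite mulnDr exprD; set x := r ^+ (2 * n); set y := r ^+ (2 * d); ring.
rewrite ler_wpM2l ?exprn_ge0 ?(ltW r0)// ler_wpM2r ?exprn_ge0 ?(ltW r0)//.
rewrite !exprMn ler_wpM2r ?sqr_ge0// lerXn2r ?nnegrE//.
by rewrite ler_nat -bin_ffact leq_pmull// bin_gt0 leq_addl.
Qed.

Lemma bin_le_exp2 n k : ('C(n, k) <= 2 ^ n)%N.
Proof.
have [kn|nk] := leqP k n; last by rewrite bin_small.
rewrite -[2%N]/(1 + 1)%N expnDn (bigD1 (Ordinal (kn : (k < n.+1)%N)))//=.
by rewrite !exp1n !muln1 leq_addr.
Qed.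

(** The d-th derivative multiplies coefficients by falling factorials of n, at
    most d! 2^n, which doubling the radius absorbs. *)
Lemma energy_diffs_le b rho s d : 0 < s -> 2 * s <= rho -> radius_ge rho b ->
  (forall k, (k < d)%N -> b k = 0) ->
  cvgn (series (fun n => b n ^+ 2 * rho ^+ (2 * n))) ->
  s ^+ (2 * d) * energy (iter d (@pseries_diffs R) b) s <= d`!%:R ^+ 2 * energy b rho.
Proof.
move=> s0 sr br b0 cb.
have sr' : 0 <= s < rho by apply/andP; split; lra.
have [cb' lb] := series_drop (d := d) (u := fun n => b n ^+ 2 * rho ^+ (2 * n))
  ltac:(by move=> k kd /=; rewrite b0// expr0n mul0r) cb.
have [c1 l1] := cvg_series_scale (d`!%:R ^+ 2) cb'.
have cd := is_cvg_energy (radius_ge_iter_diffs d br) sr'.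
have [c2 l2] := cvg_series_scale (s ^+ (2 * d)) cd.
rewrite /energy -lb -l1 -l2; apply: lim_series_le => // n.
rewrite iter_diffsE.
have -> : s ^+ (2 * d) * ((((n + d) ^_ d)%:R * b (n + d)%N) ^+ 2 * s ^+ (2 * n)) =
   b (n + d)%N ^+ 2 * (((n + d) ^_ d)%:R * s ^+ (n + d)) ^+ 2.
  rewrite ![s ^+ (2 * _)]exprM ![s ^+ 2 ^+ _]exprAC exprD.
  by set x := s ^+ n; set y := s ^+ d; set c := _%:R; set B := b _; ring.
have -> : d`!%:R ^+ 2 * (b (n + d)%N ^+ 2 * rho ^+ (2 * (n + d))) =
   b (n + d)%N ^+ 2 * (d`!%:R * rho ^+ (n + d)) ^+ 2.
  rewrite [rho ^+ (2 * _)]exprM [rho ^+ 2 ^+ _]exprAC.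
  by set x := rho ^+ _; set c := _%:R; set B := b _; ring.
have rho0 : 0 <= rho by lra.
rewrite ler_wpM2l ?sqr_ge0// lerXn2r ?nnegrE ?mulr_ge0 ?exprn_ge0 ?(ltW s0)//.
apply: (@le_trans _ _ (d`!%:R * (2 * s) ^+ (n + d))).
  rewrite exprMn mulrA ler_wpM2r ?exprn_ge0 ?(ltW s0)//.
  by rewrite -natrX -natrM ler_nat -bin_ffact mulnC leq_mul2l bin_le_exp2 orbT.
by rewrite ler_wpM2l// lerXn2r// ?nnegrE// mulr_ge0// ltW.
Qed.

(** The numerical reason for at most 2 N roots: the left exponent of 2 bounds the
    growth of the energy, the right one is a lower bound for the growth that
    2 N + 1 roots force. *)
Lemma doubling_exponent_lt d N : (0 < d)%N ->
  ((d + 3) * N < d * (2 * (2 * N).+1))%N.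
Proof.
move=> d0; have dN : (N <= d * N)%N by rewrite leq_pmull.
have -> : (d * (2 * (2 * N).+1) = 4 * (d * N) + 2 * d)%N by ring.
by rewrite mulnDl; move: (d * N)%N dN => M; lia.
Qed.

Lemma frequency_roots b r d (N : nat) : (0 < d)%N -> 0 < r ->
  let rho := 2 ^+ (d + 3) * r in
  cvgn (series (fun n => n%:R * b n ^+ 2 * rho ^+ (2 * n))) ->
  cvgn (series (fun n => b n ^+ 2 * rho ^+ (2 * n))) ->
  2 * limn (series (fun n => n%:R * b n ^+ 2 * rho ^+ (2 * n))) <=
    N%:R * energy b rho ->
  radius_ge rho b ->
  (exists m, b m != 0) -> (forall k, (k < d)%N -> b k = 0) ->
  exists zs g, [/\ (size zs <= 2 * N)%N, radius_ge rho g,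
    forall t, `|t| < rho -> psum (iter d (@pseries_diffs R) b) t =
                          \prod_(z <- zs) (t - z) * psum g t &
    forall t, `|t| <= r -> psum g t != 0].
Proof.
move=> d0 r0 rho cnum cden le_num br [m bm] b0.
have X1 : 2 <= 2 ^+ d :> R by rewrite -[leLHS]expr1 ler_weXn2l// ler1n.
have rhoE : rho = 8 * 2 ^+ d * r by rewrite /rho exprD; ring.
set X : R := 2 ^+ d in X1 rhoE.
(* Any s with 2 s <= rho and (s - r) / (2 r) >= 2^d would do. *)
pose s := 3 * X * r.
have rs : r < s by rewrite /s; nra.
have sr : 2 * s <= rho by rewrite rhoE /s; nra.
have s0 : 0 < s by exact: lt_trans rs.
have sr1 : s < rho by lra.
have rr : r < rho by lra.
have Er0 : 0 < energy b r by apply: energy_gt0 br _ bm; rewrite r0.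
set f := iter d _ b.
have fr : radius_ge rho f := radius_ge_iter_diffs d br.
have ffr := energy_diffs_ge r0 rr br b0.
have ffs := energy_diffs_le s0 sr br b0 cden.
have freq := frequency_energy_ge r0 rr cnum cden le_num br.
have D0 : 0 < d`!%:R ^+ 2 :> R by rewrite exprn_gt0// ltr0n fact_gt0.
have Ef0 : 0 < energy f r.
  have := lt_le_trans (mulr_gt0 D0 Er0) ffr.
  by rewrite pmulr_rgt0// exprn_gt0.
have Efs : energy f s <= (2 ^+ (d + 3)) ^+ N * energy f r.
  have rq : r / rho = (2 ^+ (d + 3))^-1.
    by rewrite /rho invfM mulrCA divff ?mulr1// gt_eqF.
  rewrite rq exprVn ler_pdivrMl ?exprn_gt0// in freq.
  have le_rs : r ^+ (2 * d) <= s ^+ (2 * d) by rewrite lerXn2r// ?nnegrE ltW.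
  rewrite -(ler_pM2l (x := s ^+ (2 * d))) ?exprn_gt0//.
  apply: le_trans ffs _; apply: le_trans (ler_wpM2l (ltW D0) freq) _.
  rewrite mulrCA [leRHS]mulrCA ler_wpM2l ?exprn_ge0//.
  by apply: le_trans ffr _; rewrite ler_wpM2r// ltW.
have [|zs [g [szs gr fg gn]]] := @factor_roots R rho r s (2 * N).+1 f r0 rs sr1 fr Ef0.
  apply: le_lt_trans Efs _; rewrite ltr_pM2r//.
  apply: (@lt_le_trans _ _ (X ^+ (2 * (2 * N).+1))).
    rewrite /X -!exprM ltr_eXn2l ?ltr1n//.
    exact: doubling_exponent_lt.
  rewrite lerXn2r ?nnegrE//; first by lra.
    by rewrite divr_ge0//; lra.
  rewrite ler_pdivlMr; last by lra.
  by rewrite /s; nra.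
by exists zs, g.
Qed.

End frequency_bounds.

(** * One-sided derivatives of power series *)

Section derive_within.
Variable R : realType.
Implicit Types (f h : R -> R) (x y t : R).

(** Makes the limit in [derive_within] unique, also at the endpoints. *)
Lemma within_dnbhs_itv_proper x y t : x < y -> x <= t <= y ->
  ProperFilter (within `[x, y]%classic t^').
Proof.
move=> xy /andP[xt ty]; apply: Build_ProperFilter => -.
move=> /nbhs_ballP[e /= e0 He].
have [yt|] := ltP t y.
  have [s /andP[ts se] sy] : exists2 s, t < s < t + e & s <= y.
    by exists ((t + Num.min y (t + e)) / 2); case: (leP y (t + e)) => ?; lra.
  apply: (He s) => /=.
  - by rewrite /ball/= distrC gtr0_norm; lra.
  - by rewrite gt_eqF.
  - by rewrite in_itv/= sy (le_trans xt)// ltW.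
move=> yt; have [s /andP[st se] sx] : exists2 s, t - e < s < t & x <= s.
  by exists ((t + Num.max x (t - e)) / 2); case: (leP x (t - e)) => ?; lra.
apply: (He s) => /=.
- by rewrite /ball/= gtr0_norm; lra.
- by rewrite lt_eqF.
- by rewrite in_itv/= sx; lra.
Qed.

Lemma derive_within_itv x y f h t D : x < y ->
  (forall s, x <= s <= y -> f s = h s) -> x <= t <= y ->
  is_derive t 1 h D -> derive_within `[x, y]%classic f t = D.
Proof.
move=> xy fh txy [dh <-].
have pf := within_dnbhs_itv_proper xy txy.
apply: cvg_lim => //; apply/cvgrPdist_lt => e e0.
have /cvgrPdist_lt/(_ _ e0)/nbhs_ballP[d /= d0 Hd] := dh.
apply/nbhs_ballP; exists d => //= s std st; rewrite in_itv/= => sxy.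
rewrite !fh//; have := Hd (s - t).
rewrite /ball/= sub0r normrN distrC => /(_ std).
rewrite subr_eq0 => /(_ st); rewrite /= scaler1 subrK /GRing.scale/= mulrC.
exact.
Qed.

Lemma deriven_within_itv x y f (D : nat -> R -> R) n : x < y ->
  (forall k t, x <= t <= y -> is_derive t 1 (D k) (D k.+1 t)) ->
  (forall t, x <= t <= y -> f t = D 0%N t) ->
  forall t, x <= t <= y -> deriven_within `[x, y]%classic n f t = D n t.
Proof.
move=> xy dD fD; elim: n => [|n IH] t txy; first exact: fD.
by rewrite /deriven_within iterS; apply: derive_within_itv IH txy (dD n t txy).
Qed.

End derive_within.

Section analytic.
Variable R : realType.
Implicit Types (b : R^nat) (phi : R -> R) (a r rho t : R).

(** The k-th derivative of the power series with centre a. *)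
Definition psum_derivn b a k t := psum (iter k (@pseries_diffs R) b) (t - a).

Lemma is_derive_psum_derivn b a rho k t : radius_ge rho b -> `|t - a| < rho ->
  is_derive t 1 (psum_derivn b a k) (psum_derivn b a k.+1 t).
Proof.
move=> br tr.
have d1 := is_derive_psum (radius_ge_iter_diffs k br) tr.
have d2 : is_derive t 1 (fun u : R => u - a) 1 := is_derive_shift t 1 (- a).
have := @is_derive1_comp _ _ (fun u : R => u - a) t _ _ d1 d2; rewrite mulr1; exact.
Qed.

Lemma deriven_within_psum b a r rho phi n t : 0 < r -> r < rho ->
  radius_ge rho b -> (forall t, a - r <= t <= a + r -> phi t = psum b (t - a)) ->
  a - r <= t <= a + r ->
  deriven_within (centered_itv a r) n phi t = psum_derivn b a n t.
Proof.
move=> r0 rr br phib; apply: deriven_within_itv => //; first by lra.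
move=> k u /andP[u1 u2]; apply: (is_derive_psum_derivn (rho := rho)) => //.
by rewrite (le_lt_trans _ rr)// ler_norml; lra.
Qed.

Lemma psum_derivn_center b a k : psum_derivn b a k a = k`!%:R * b k.
Proof. by rewrite /psum_derivn subrr psum0 iter_diffsE add0n ffactnn. Qed.

(** The derivatives on the interval are determined by the function, and at the
    centre they are the coefficients times factorials. *)
Lemma psum_eq0 b r rho : 0 < r -> r < rho -> radius_ge rho b ->
  (forall t, - r <= t <= r -> psum b t = 0) -> forall n, b n = 0.
Proof.
move=> r0 rr br bz n.
have zr : radius_ge rho (fun=> 0 : R).
  by move=> s _; exists 0 => m; rewrite normr0 mul0r.
have h b' : radius_ge rho b' -> (forall t, - r <= t <= r -> psum b' t = 0) ->
  deriven_within (centered_itv 0 r) n (fun=> 0) 0 = n`!%:R * b' n.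
  move=> br' bz'; rewrite -(psum_derivn_center b' 0).
  apply: deriven_within_psum br' _ _ => //; last by lra.
  by move=> t; rewrite sub0r add0r => tr; rewrite subr0 bz'.
have z0 t : - r <= t <= r -> psum (fun=> 0 : R) t = 0.
  move=> _; rewrite /psum (_ : pseries _ _ = fun=> 0) ?lim_cst//.
  by apply/funext => m; rewrite /pseries/series/= big1// => i _; rewrite mul0r.
have := h b br bz; rewrite (h _ zr z0) mulr0 => /esym/eqP.
by rewrite mulf_eq0 pnatr_eq0 -leqn0 leqNgt fact_gt0/= => /eqP.
Qed.

End analytic.

(** * Real coefficients of a class of analytic functions *)
Section complex_coefficients.
Import ComplexField.Normc.
Local Open Scope complex_scope.
Variable R : realType.
Implicit Types (a r rho t : R) (c : nat -> R[i]) (phi : R -> R).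

Lemma normc_sqr (z : R[i]) : normc z ^+ 2 = complex.Re z ^+ 2 + complex.Im z ^+ 2.
Proof. by case: z => x y /=; rewrite sqr_sqrtr// addr_ge0 ?sqr_ge0. Qed.

Lemma norm_Re_le_normc (z : R[i]) : `|complex.Re z| <= normc z.
Proof. by case: z => x y /=; rewrite -sqrtr_sqr ler_wsqrtr// lerDl sqr_ge0. Qed.

Lemma norm_Im_le_normc (z : R[i]) : `|complex.Im z| <= normc z.
Proof. by case: z => x y /=; rewrite -sqrtr_sqr ler_wsqrtr// lerDr sqr_ge0. Qed.

Lemma cvg_normc (u : nat -> R[i]) (l : R[i]) :
  (u : nat -> R[i]^o) @ \oo --> (l : R[i]^o) ->
  forall e : R, 0 < e -> \forall n \near \oo, normc (l - u n) < e.
Proof.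
move=> ul e e0; move/cvgrPdist_lt : ul => /(_ e%:C).
rewrite ltcR => /(_ e0); apply: filterS => n.
by rewrite ltcR.
Qed.

Lemma cvg_Re_Im (u : nat -> R[i]) (l : R[i]) :
  (u : nat -> R[i]^o) @ \oo --> (l : R[i]^o) ->
  (fun n => complex.Re (u n)) @ \oo --> complex.Re l /\
  (fun n => complex.Im (u n)) @ \oo --> complex.Im l.
Proof.
move=> ul; split; apply/cvgrPdist_lt => e e0;
  apply: filterS (cvg_normc ul e0) => n; apply: le_lt_trans.
- by rewrite -raddfB norm_Re_le_normc.
- by rewrite -raddfB norm_Im_le_normc.
Qed.

Lemma series_Re_Im c (x : R) n :
  complex.Re (series (fun k => c k * x%:C ^+ k) n) =
    series (fun k => complex.Re (c k) * x ^+ k) n /\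
  complex.Im (series (fun k => c k * x%:C ^+ k) n) =
    series (fun k => complex.Im (c k) * x ^+ k) n.
Proof.
split; rewrite /series /= raddf_sum; apply: eq_bigr => k _;
  rewrite -rmorphXn /=; case: (c k) => u v /=; ring.
Qed.

(** The real parts of the Taylor coefficients of the extension represent phi on
    the interval, and the imaginary parts represent zero there, so that they
    vanish by [psum_eq0].  The frequency is then that of a real sequence. *)
Lemma class_A_real_coefficients a r rho (N : nat) phi :
  0 < r -> r < rho -> class_A a r N rho phi ->
  exists b : R^nat,
  [/\ cvgn (series (fun n => n%:R * b n ^+ 2 * rho ^+ (2 * n))) /\
      cvgn (series (fun n => b n ^+ 2 * rho ^+ (2 * n))),
      2 * limn (series (fun n => n%:R * b n ^+ 2 * rho ^+ (2 * n))) <=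
        N%:R * energy b rho,
      radius_ge rho b, exists m, b m != 0 &
      forall t, a - r <= t <= a + r -> phi t = psum b (t - a)].
Proof.
move=> r0 rr [Phi [_ Phiphi [[z0 z0D Phiz0] [c [cP cnum cden le_N]]]]].
have rho0 : 0 < rho by exact: lt_trans rr.
pose b n := complex.Re (c n); pose d n := complex.Im (c n).
have c_bnd : exists A, forall n, normc (c n) ^+ 2 * rho ^+ (2 * n) <= A.
  have [K [_ KP]] := cvg_series_bounded cden.
  exists (K + 1) => n; apply: le_trans (ler_norm _) _.
  by apply: (KP (K + 1)) => //; rewrite ltrDl.
have radius x : (forall n, `|x n| <= normc (c n)) -> radius_ge rho x.
  move=> xc s /andP[s0 sr]; have [A cA] := c_bnd.
  exists (Num.sqrt A) => n.
  rewrite -[leLHS]ger0_norm ?mulr_ge0 ?exprn_ge0// -sqrtr_sqr ler_sqrt; last first.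
    by apply: le_trans (cA n); rewrite mulr_ge0 ?sqr_ge0 ?exprn_ge0 ?(ltW rho0).
  apply: le_trans (cA n); rewrite exprMn mulnC exprM ler_pM ?sqr_ge0//.
    by rewrite lerXn2r ?nnegrE// (le_trans _ (xc n)).
  by rewrite lerXn2r ?nnegrE ?exprn_ge0 ?(ltW rho0)// lerXn2r ?nnegrE ?(ltW rho0)// ltW.
have br : radius_ge rho b by apply: radius => n; exact: norm_Re_le_normc.
have dr : radius_ge rho d by apply: radius => n; exact: norm_Im_le_normc.
have parts t : a - r <= t <= a + r -> phi t = psum b (t - a) /\ psum d (t - a) = 0.
  move=> tI.
  have tE : t%:C - a%:C = (t - a)%:C :> R[i].
    by apply/eqP; rewrite eq_complex /= subr0 !eqxx.
  have tD : disc a%:C rho t%:C.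
    rewrite /disc /mkset tE /= expr0n/= addr0 sqrtr_sqr.
    by rewrite (le_lt_trans _ rr)// ler_norml; lra.
  have := cP _ tD; rewrite tE Phiphi; last by rewrite /centered_itv/= in_itv.
  move=> /cvg_Re_Im.
  have -> : (fun n => complex.Re (series (fun k => c k * (t - a)%:C ^+ k) n)) =
      pseries b (t - a).
    by apply/funext => n; have [-> _] := series_Re_Im c (t - a) n.
  have -> : (fun n => complex.Im (series (fun k => c k * (t - a)%:C ^+ k) n)) =
      pseries d (t - a).
    by apply/funext => n; have [_ ->] := series_Re_Im c (t - a) n.
  by move=> [/cvg_lim h1 /cvg_lim h2]; split; [rewrite /psum h1|rewrite /psum h2].
have d0 n : d n = 0.
  apply: (psum_eq0 r0 rr dr) => t tr.
  have [|_] := parts (t + a); first by lra.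
  by rewrite addrK.
have cb n : normc (c n) ^+ 2 = b n ^+ 2.
  by rewrite normc_sqr -/(b n) -/(d n) d0 expr0n addr0.
have num_eq : freq_num c rho = series (fun n => n%:R * b n ^+ 2 * rho ^+ (2 * n)).
  by rewrite /freq_num; congr series; apply/funext => n; rewrite cb.
have den_eq : freq_den c rho = series (fun n => b n ^+ 2 * rho ^+ (2 * n)).
  by rewrite /freq_den; congr series; apply/funext => n; rewrite cb.
rewrite /frequency num_eq den_eq in cnum cden le_N.
have [m bm] : exists m, b m != 0.
  apply: contrapT => nb.
  have b0 n : b n = 0 by apply/eqP/negPn/negP => bn; apply: nb; exists n.
  have c0 n : c n = 0.
    by have := b0 n; have := d0 n; rewrite /b /d; case: (c n) => x y /= -> ->.
  move: Phiz0; have := cP _ z0D.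
  rewrite (_ : series _ = fun=> 0 : R[i]^o); last first.
    by apply/funext => n; rewrite /series/= big1// => i _; rewrite c0 mul0r.
  move=> /cvg_Re_Im[] /cvg_lim; rewrite lim_cst// => h1 /cvg_lim; rewrite lim_cst// => h2.
  by move/eqP; apply; move: h1 h2; case: (Phi z0) => x y /= <-// <-.
exists b; split => //; last by move=> t /parts[].
  have W0 : 0 < energy b rho.
    have bt n : 0 <= b n ^+ 2 * rho ^+ (2 * n) := energy_term_ge0 b rho n.
    apply: lt_le_trans (lim_series_ge0 bt cden m).
    by apply: mulr_gt0; [rewrite exprn_even_gt0|exact: exprn_gt0].
  by rewrite -ler_pdivrMr// -mulrA.
by exists m.
Qed.

End complex_coefficients.

(** * Divided differences under a power weight *)

Section power_weight.
Variable R : realType.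
Implicit Types (D : nat -> R -> R) (h : R -> R) (x y p t : R) (s : seq R).

Lemma derivn_XsubC_exp p m n :
  (('X - p%:P) ^+ (m + n))^`(n) = ((m + n) ^_ n)%:R *: ('X - p%:P) ^+ m :> {poly R}.
Proof.
elim: n => [|n IH]; first by rewrite addn0 ffactn0 scale1r derivn0.
rewrite derivSn deriv_exp derivXsubC mul1r addnS /= derivnMn IH.
by rewrite ffactSS natrM -scalerA [RHS]scaler_nat.
Qed.

Lemma constant_sign x y h : x <= y ->
  {within `[x, y], continuous h} -> (forall t, x <= t <= y -> h t != 0) ->
  exists2 e, e = 1 \/ e = -1 & forall t, x <= t <= y -> 0 < e * h t.
Proof.
move=> xy hc hn.
have same t : x <= t <= y -> 0 < h x * h t.
  move=> /andP[xt ty]; rewrite ltNge; apply/negP => hx.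
  have [||c cI hc0] := @IVT R h x t 0 xt.
  - apply: continuous_subspaceW hc => u /=; rewrite !in_itv/=.
    by move=> /andP[-> /le_trans]; exact.
  - case: (leP (h x) (h t)) => ?; apply/andP; split; nra.
  have : h c != 0 by apply: hn; move: cI; rewrite in_itv/= => /andP[-> /le_trans]; exact.
  by rewrite hc0 eqxx.
have hx0 : h x != 0 by apply: hn; rewrite lexx.
case: (ltgtP (h x) 0) hx0 => // hx _.
  by exists (-1); [right|move=> t /same; nra].
by exists 1; [left|move=> t /same; nra].
Qed.

(** The comparison function is the multiple of (t - p)^(m+n) whose n-th derivative
    is c |t - p|^m up to sign: subtracting it from D 0 leaves a function whose
    n-th derivative keeps its sign, hence so does its divided difference.  The
    constants c and C are the extrema of |h|. *)
Lemma divdiff_ge_power_weight D x y p (e : R) m n :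
  x < y -> e = 1 \/ e = -1 -> (forall t, x <= t <= y -> 0 <= e * (t - p)) ->
  (forall k t, x <= t <= y -> is_derive t 1 (D k) (D k.+1 t)) ->
  forall h, (forall t, x <= t <= y -> D n t = (t - p) ^+ m * h t) ->
  {within `[x, y], continuous h} -> (forall t, x <= t <= y -> h t != 0) ->
  ((forall t, x <= t <= y -> 0 <= D n t) \/ (forall t, x <= t <= y -> D n t <= 0)) /\
  exists c C K, [/\ 0 < c, 0 < C, 0 < K,
    forall t, x <= t <= y -> c * `|p - t| ^+ m <= `|D n t| <= C * `|p - t| ^+ m &
    forall s, size s = n.+1 -> uniq s -> {in s, forall t, x <= t <= y} ->
      {in s, forall t, K * `|D n t| <= `|divdiff s (D 0%N)|}].
Proof.
move=> xy e1 ep dD h Dh hc hn.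
have ee : e * e = 1 by case: e1 => ->; ring.
have [q q1 hq] := constant_sign (ltW xy) hc hn.
have qq : q * q = 1 by case: q1 => ->; ring.
have normq : `|q| = 1 by case: q1 => ->; rewrite ?normrN normr1.
have norme : `|e| = 1 by case: e1 => ->; rewrite ?normrN normr1.
have absE t : x <= t <= y -> `|p - t| = e * (t - p).
  by move=> txy; rewrite distrC -[LHS]mul1r -norme -normrM ger0_norm// ep.
have hE t : x <= t <= y -> `|h t| = q * h t.
  by move=> txy; rewrite -[LHS]mul1r -normq -normrM ger0_norm// ltW// hq.
have DE t : x <= t <= y -> `|D n t| = `|p - t| ^+ m * `|h t|.
  by move=> txy; rewrite Dh// normrM normrX distrC.
pose tau := q * e ^+ m.
have tauD t : x <= t <= y -> tau * D n t = `|D n t|.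
  move=> txy; rewrite DE// Dh// absE// hE// /tau exprMn.
  by set u := (t - p) ^+ m; set v := e ^+ m; ring.
have tau2 : tau * tau = 1.
  rewrite /tau mulrACA qq mul1r -exprMn ee expr1n//.
have normtau : `|tau| = 1 by rewrite /tau normrM normq normrX norme expr1n mulr1.
split.
  have [t0|t0] := leP 0 tau; [left|right] => t txy.
    have := tauD t txy; have : tau = 1 by rewrite -normtau ger0_norm.
    by move=> ->; rewrite mul1r => ->.
  have := tauD t txy; have : - tau = 1 by rewrite -normtau ltr0_norm.
  move=> /eqP; rewrite eqr_oppLR => /eqP ->; rewrite mulN1r => h1.
  by rewrite -oppr_ge0 h1.
have nc : {within `[x, y], continuous (fun t => q * h t)}.
  by move=> t; apply: cvgM; [exact: cvg_cst|exact: hc].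
have [cmin cminI minP] := EVT_min (ltW xy) nc.
have [cmax cmaxI maxP] := EVT_max (ltW xy) nc.
rewrite !in_itv/= in cminI cmaxI.
set c := q * h cmin in minP; set C := q * h cmax in maxP.
have c0 : 0 < c by exact: hq.
have C0 : 0 < C by exact: hq.
have bnd t : x <= t <= y -> c * `|p - t| ^+ m <= `|D n t| <= C * `|p - t| ^+ m.
  move=> txy; rewrite DE// [`|p - t| ^+ m * _]mulrC hE//.
  have tI : t \in `[x, y] by rewrite in_itv.
  by rewrite !ler_wpM2r ?exprn_ge0// ?minP ?maxP.
pose M := (m + n)%N.
have F0 : 0 < (M ^_ n)%:R :> R by rewrite ltr0n ffact_gt0 leq_addl.
exists c, C, (c / (C * (M ^_ n)%:R)); split=> //.
  by rewrite divr_gt0// mulr_gt0.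
move=> s szs us sxy t ts.
pose A := c * e ^+ m / (M ^_ n)%:R.
pose P := A *: ('X - p%:P) ^+ M.
have sep : {in s, forall t, 0 <= e * (t - p)} by move=> u /sxy/ep.
have h0 : 0 <= divdiff s (fun t => tau * D 0%N t - P.[t]).
  apply: (@divdiff_ge0 R n (fun k t => tau * D k t - P^`(k).[t]) x y s) => //.
    move=> k u uxy; have := dD k u uxy => dDk; rewrite derivnS.
    by apply: is_deriveB; exact: is_deriveZ.
  move=> u uxy; rewrite tauD// subr_ge0 /P derivnZ derivn_XsubC_exp.
  rewrite !hornerZ horner_exp hornerXsubC /A -/M.
  have /andP[h1 _] := bnd u uxy; apply: le_trans h1.
  rewrite absE// exprMn le_eqVlt; apply/orP; left; apply/eqP.
  by set v := (u - p) ^+ m; set w := e ^+ m; field; rewrite gt_eqF.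
have txy := sxy t ts.
have PE : divdiff s (horner P) = A * divdiff s (fun t => (t - p) ^+ M).
  rewrite -divdiffZ; apply: eq_divdiff => u _.
  by rewrite /P hornerZ horner_exp hornerXsubC.
rewrite divdiffB divdiffZ PE in h0.
apply: (@le_trans _ _ (tau * divdiff s (D 0%N))); last first.
  by rewrite (le_trans (ler_norm _))// normrM normtau mul1r.
rewrite subr_ge0 in h0; apply: le_trans h0.
have /andP[_ h2] := bnd t txy.
have h3 := @divdiff_exp_ge R e p s n m szs us sep t ts.
have cCF : 0 < c / (C * (M ^_ n)%:R) by rewrite divr_gt0// mulr_gt0.
apply: le_trans (ler_wpM2l (ltW cCF) h2) _.
have cF : 0 < c / (M ^_ n)%:R by rewrite divr_gt0.
rewrite (_ : A * _ =
  c / (M ^_ n)%:R * (e ^+ m * divdiff s (fun t => (t - p) ^+ M))); last first.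
  by rewrite /A; set w := e ^+ m; set dd := divdiff _ _; field; rewrite gt_eqF.
apply: le_trans (ler_wpM2l (ltW cF) h3).
rewrite absE// le_eqVlt; apply/orP; left; apply/eqP.
by set w := (_ * _) ^+ m; field; rewrite !gt_eqF.
Qed.

End power_weight.

(** * The Jacobian determinant *)

Section jacobian.
Variable R : realType.
Implicit Types (b : R^nat) (phi : R -> R) (a r rho K delta : R).

(** The geometric mean of the w l is at most their maximum. *)
Lemma prod_powR_le n (w : 'I_n -> R) K delta : (0 < n)%N -> 0 < K ->
  (forall l, 0 <= w l) -> (forall l, K * w l <= delta) ->
  K * \prod_(l < n) (w l `^ n%:R^-1) <= delta.
Proof.
move=> n0 K0 w0 Kw; rewrite mulrC -ler_pdivlMr//.
have d0 : 0 <= delta / K.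
  by rewrite divr_ge0// ?(ltW K0)// (le_trans _ (Kw (Ordinal n0)))// mulr_ge0// ltW.
have -> : delta / K = \prod_(l < n) ((delta / K) `^ n%:R^-1).
  rewrite prodr_const card_ord -powR_mulrn ?powR_ge0// -powRrM mulVf ?powRr1//.
  by rewrite pnatr_eq0 -lt0n.
apply: ler_prod => l _; rewrite powR_ge0/= ge0_ler_powR ?nnegrE ?invr_ge0//.
by rewrite ler_pdivlMr// mulrC.
Qed.

Lemma Gamma_set_coord d phi (t : 'rV[R]_d) (i j : 'I_d) (s : R) :
  Gamma phi (set_coord t j s) 0 i =
  simple_curve d phi s 0 i +
  \sum_(l < d | l != j) simple_curve d phi (t 0 l) 0 i.
Proof.
have tE l : set_coord t j s 0 l = if l == j then s else t 0 l by rewrite mxE.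
rewrite /Gamma summxE (bigD1 j)//= tE eqxx; congr (_ + _).
by apply: eq_bigr => l lj; rewrite tE (negbTE lj).
Qed.

(** The function psum_derivn b a 1 is phi', which makes up the
    last row.  The other rows contribute the factor n!, at least 1. *)
Lemma jacobian_det_ge n b a r rho phi (t : 'rV[R]_n.+1) : 0 < r -> r < rho ->
  radius_ge rho b -> (forall u, a - r <= u <= a + r -> phi u = psum b (u - a)) ->
  (forall l, a - r <= t 0 l <= a + r) -> injective (t 0) ->
  `|divdiff [seq t 0 l | l <- enum 'I_n.+1] (psum_derivn b a 1)| *
    \prod_(l < n.+1) \prod_(m < n.+1 | (l < m)%N) `|t 0 m - t 0 l| <=
  `|jacobian_det (centered_itv a r) (Gamma phi) t|.
Proof.
move=> r0 rr br phib tI tinj.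
have -> : jacobian_det (centered_itv a r) (Gamma phi) t =
    \det (\matrix_(i < n.+1, j < n.+1)
      (if i == n :> nat then psum_derivn b a 1 (t 0 j) else i.+1%:R * t 0 j ^+ i)).
  congr (\det _); apply/matrixP => i j; rewrite !mxE /partial_within.
  set cst_part := \sum_(l < n.+1 | l != j) simple_curve n.+1 phi (t 0 l) 0 i.
  pose h s := (if i == n :> nat then psum_derivn b a 0 s else s ^+ i.+1) + cst_part.
  apply: (@derive_within_itv _ _ _ _ h) => //; first by lra.
    move=> s sI; rewrite Gamma_set_coord /h mxE eqSS.
    by case: ifP => // _; rewrite phib.
  rewrite /h -[X in is_derive _ _ _ X]addr0; apply: is_deriveD.
  case: ifP => _.
    apply: (is_derive_psum_derivn (rho := rho)) => //.
    by rewrite (le_lt_trans _ rr)// ler_norml; have := tI j; lra.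
  rewrite (_ : (fun s : R => s ^+ i.+1) = horner 'X^(i.+1)); last first.
    by apply/funext => s; rewrite hornerXn.
  apply: (trigger_derive (is_derive_poly _ _)).
  by rewrite derivXn hornerMn hornerXn mulr_natl.
rewrite (det_power_rows (fun i => i.+1%:R))// !normrM.
set V := \prod_(l < n.+1) _; set W := (X in _ <= _ * _ * X).
have -> : W = V.
  by rewrite /W normr_prod; apply: eq_bigr => i _; rewrite normr_prod.
rewrite ler_wpM2r//.
  by apply: prodr_ge0 => i _; apply: prodr_ge0.
rewrite -[leLHS]mul1r ler_wpM2r// ger0_norm ?prodr_ge0//.
by rewrite -natr_prod ler1n; apply: prodn_gt0.
Qed.

End jacobian.

(** * The decomposition *)
Section interval_chain.
Variable R : realType.
Implicit Types (x y t z : R) (s c L : seq R).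

Lemma path_cover x s t : x <= t <= last x s -> (0 < size s)%N ->
  exists2 i, (i < size s)%N & nth x (x :: s) i <= t <= nth x (x :: s) i.+1.
Proof.
elim: s x => [//|e s IH] x /= /andP[xt tl] _.
have [te|et] := leP t e; first by exists 0%N => //=; rewrite xt.
have [||i is_ it] := IH e.
- by rewrite ltW.
- by case: s tl {IH} => //=; rewrite leNgt et.
have nthE k : (k < size (e :: s))%N -> nth e (e :: s) k = nth x (e :: s) k.
  exact: set_nth_default.
by exists i.+1 => //; move: it; rewrite !nthE//= ltnW.
Qed.

(** For a number of pieces that is the same for all functions: only an upper
    bound n for the number of breakpoints is uniform, so superfluous ones are
    inserted, as midpoints of the first gap. *)
Lemma path_refine x y c n : path <%R x (rcons c y) -> (size c <= n)%N ->
  exists c', [/\ path <%R x (rcons c' y), size c' = n & {subset c <= c'}].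
Proof.
move=> pc cn; rewrite -(subnK cn); elim: (n - size c)%N => [|k [c' [pc' sc' cc']]].
  by exists c; split.
exists ((x + head y c') / 2 :: c'); split; last 2 first.
- by rewrite /= sc'.
- by move=> z /cc' zc; rewrite inE zc orbT.
case: c' pc' {sc' cc'} => [|e c'] /=.
  by rewrite !andbT => h; apply/andP; split; lra.
by move=> /andP[h ->]; rewrite andbT; apply/andP; split; lra.
Qed.

(** The breakpoints are the points of L in the open interval, filled up to
    exactly n. *)
Lemma interval_decomposition x y L n : x < y -> (size L <= n)%N ->
  exists u v : 'I_n.+1 -> R, itv_decomposition `[x, y]%classic u v /\
    forall j, [/\ x <= u j, v j <= y & {in L, forall z, ~~ (u j < z < v j)}].
Proof.
move=> xy Ln; pose c0 := sort <=%R (undup [seq z <- L | x < z < y]).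
have c0P z : (z \in c0) = (x < z < y) && (z \in L).
  by rewrite mem_sort mem_undup mem_filter.
have c0n : (size c0 <= n)%N.
  rewrite size_sort (leq_trans (size_undup _))// size_filter.
  by rewrite (leq_trans (count_size _ _)).
have pc0 : path <%R x (rcons c0 y).
  have : sorted <%R c0 by rewrite sort_lt_sorted undup_uniq.
  rewrite rcons_path; case: c0 c0P {c0n} => [|e c] cP /= ec; first by rewrite xy.
  have /andP[/andP[xe ey] _] : (x < e < y) && (e \in L) by rewrite -cP mem_head.
  rewrite xe ec /=.
  by have := mem_last e c; rewrite cP => /andP[/andP[]].
have [c [pc sc c0c]] := path_refine pc0 c0n.
pose s := x :: rcons c y.
have ss : size s = n.+2 by rewrite /= size_rcons sc.
have srt : sorted <%R s by exact: pc.
have lt_nth i j : (j < n.+2)%N -> (i < j)%N -> nth x s i < nth x s j.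
  move=> jn ij; apply: (sorted_ltn_nth lt_trans) => //; rewrite inE ss//.
  exact: ltn_trans jn.
have le_nth i j : (j < n.+2)%N -> (i <= j)%N -> nth x s i <= nth x s j.
  by move=> jn; rewrite leq_eqVlt => /predU1P[->//|/(lt_nth _ _ jn)/ltW].
have s0 : nth x s 0 = x by [].
have sn : nth x s n.+1 = y by rewrite /= nth_rcons sc ltnn eqxx.
pose u (j : 'I_n.+1) := nth x s j; pose v (j : 'I_n.+1) := nth x s j.+1.
have uv j : u j < v j by apply: lt_nth => //; rewrite ltnS.
have xu j : x <= u j by rewrite -{1}s0; apply: le_nth => //; rewrite ltnS ltnW.
have vy j : v j <= y by rewrite -sn; apply: le_nth.
exists u, v; split; last first.
  move=> j; split=> // z zL; apply/negP => /andP[uz zv].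
  have zs : z \in s.
    rewrite in_cons mem_rcons in_cons c0c ?orbT// c0P zL andbT.
    by rewrite (le_lt_trans (xu j))// (lt_le_trans zv).
  have zi := nth_index x zs; have is_ : (index z s < n.+2)%N by rewrite -ss index_mem.
  have [ij|ji] := leqP (index z s) j.
    have := le_nth _ j (leq_trans (ltn_ord j) (leqnSn _)) ij.
    by rewrite zi leNgt uz.
  by have := le_nth _ _ is_ ji; rewrite zi leNgt zv.
split => //.
- apply/seteqP; split => t /=.
    rewrite in_itv/= => txy.
    have [||i is_ it] := @path_cover x (rcons c y) t.
    - by rewrite last_rcons.
    - by rewrite size_rcons.
    rewrite size_rcons sc in is_.
    by exists (Ordinal is_) => //=; rewrite in_itv.
  move=> [j _]; rewrite /= !in_itv/= => /andP[ut tv].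
  by rewrite (le_trans (xu j))//= (le_trans tv).
move=> i j ij t /= [] /=; rewrite !in_itv/= => /andP[uit tvi] /andP[ujt tvj].
have [lij|lji|/val_inj eij] := ltngtP i j; last by rewrite eij eqxx in ij.
  right; apply/eqP; rewrite eq_le tvi/= (le_trans _ ujt)//.
  by apply: le_nth => //; rewrite ltnS ltnW.
left; apply/eqP; rewrite eq_le uit andbT (le_trans tvj)//.
by apply: le_nth => //; rewrite ltnS ltnW.
Qed.

End interval_chain.

Section roots_on_interval.
Variable R : realType.
Implicit Types (x y p t z : R) (Z : seq R).

Lemma prod_sub_split Z p t :
  \prod_(z <- Z) (t - z) =
  (t - p) ^+ count_mem p Z * \prod_(z <- Z | z != p) (t - z).
Proof.
elim: Z => [|z Z IH]; first by rewrite !big_nil expr0 mulr1.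
rewrite !big_cons /= IH; have [->|_] := eqVneq z p; first by rewrite exprS mulrA.
by rewrite add0n mulrCA.
Qed.

(** Additional breakpoints, which keep two roots from being the two endpoints of
    the same piece. *)
Definition midpoints Z := [seq (z + w) / 2 | z <- Z, w <- Z].

(** The centre p is the root at an endpoint if there is one.  Otherwise y + 1 is
    taken, which works with the exponent 0, or with a positive one if it is
    itself a root. *)
Lemma root_centre Z x y : x < y ->
  {in Z ++ midpoints Z, forall z, ~~ (x < z < y)} ->
  exists p (e : R), [/\ e = 1 \/ e = -1,
    forall t, x <= t <= y -> 0 <= e * (t - p),
    {in Z, forall z, x <= z <= y -> z = p} &
    x <= p <= y -> (p = x \/ p = y) /\ p \in Z].
Proof.
move=> xy Zxy.
have endpoint z : z \in Z -> x <= z <= y -> z = x \/ z = y.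
  move=> zZ /andP[]; rewrite le_eqVlt => /predU1P[->|xz]; first by left.
  rewrite le_eqVlt => /predU1P[->|zy]; first by right.
  have := Zxy z; rewrite mem_cat zZ xz zy; by move/(_ isT).
have [xZ|xZ] := boolP (x \in Z).
  exists x, 1; split; first by left.
  - by move=> t /andP[xt _]; rewrite mul1r subr_ge0.
  - move=> z zZ /(endpoint z zZ)[//|zy]; exfalso.
    have mZ : (x + y) / 2 \in Z ++ midpoints Z.
      rewrite mem_cat; apply/orP; right.
      by apply/allpairsP; exists (x, y); split => //=; rewrite -zy.
    have /negP := Zxy _ mZ; apply; apply/andP; split; lra.
  - by move=> _; split => //; left.
have [yZ|yZ] := boolP (y \in Z).
  exists y, (-1); split; first by right.
  - by move=> t /andP[_ ty]; rewrite mulN1r opprB subr_ge0.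
  - by move=> z zZ /(endpoint z zZ)[zx|//]; rewrite -zx zZ in xZ.
  - by move=> _; split => //; right.
exists (y + 1), (-1); split; first by right.
- by move=> t /andP[_ ty]; lra.
- by move=> z zZ /(endpoint z zZ)[] ez; [rewrite -ez zZ in xZ|rewrite -ez zZ in yZ].
- by move=> /andP[_]; lra.
Qed.

End roots_on_interval.

Theorem theorem1p2 (R : realType) (d : nat) (hd : (0 < d)%N)
    (a r : R) (hr : 0 < r) (N : nat) :
  exists M : nat, forall phi : R -> R,
    class_A0 d a r N (2 ^+ (d + 3) * r) phi ->
    let I := centered_itv a r in
    let phid := deriven_within I d phi in
    exists x y : 'I_M -> R,
      itv_decomposition I x y /\
      forall j : 'I_M,
        let Ij := `[x j, y j]%classic in
        single_signed_on Ij phid /\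
        exists (c C K aj : R) (k : int),
          [/\ [/\ 0 < c, 0 < C & 0 < K],
              (* the centre is outside Ij, except that it may be an endpoint
                 of Ij at which phid vanishes *)
              Ij aj -> (aj = x j \/ aj = y j) /\ phid aj = 0,
              k <= (2 * N)%:Z,
              (forall t, Ij t ->
                 c * `|aj - t| ^ k <= `|phid t| /\
                 `|phid t| <= C * `|aj - t| ^ k) &
              forall t : 'rV[R]_d, (forall l, Ij (t 0 l)) ->
                K * ((\prod_(l < d) (`|phid (t 0 l)| `^ d%:R^-1)) *
                     \prod_(l < d) \prod_(m < d | (l < m)%N)
                        `|t 0 m - t 0 l|)
                <= `|jacobian_det I (Gamma phi) t|].
Proof.
case: d hd => [//|n] _.
exists (2 * N + 2 * N * (2 * N)).+1 => phi [phiA phi0] I phid.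
set rho := 2 ^+ (n.+1 + 3) * r in phiA.
have rr : r < rho.
  by rewrite -[ltLHS]mul1r ltr_pM2r// exprn_egt1// ?ltr1n// addnS.
have [b [[cnum cden] le_N br b_neq0 phib]] := class_A_real_coefficients hr rr phiA.
have phidE k t : a - r <= t <= a + r ->
    deriven_within I k phi t = psum_derivn b a k t.
  exact: deriven_within_psum br phib.
have b0 k : (k < n.+1)%N -> b k = 0.
  move=> /phi0; rewrite -/I phidE; last by lra.
  rewrite psum_derivn_center => /eqP.
  by rewrite mulf_eq0 pnatr_eq0 -leqn0 leqNgt fact_gt0/= => /eqP.
have [zs [g [szs gr fg gn]]] :=
  frequency_roots (ltn0Sn n) hr cnum cden le_N br b_neq0 b0.
pose Z := [seq a + z | z <- zs].
have sZ : (size Z <= 2 * N)%N by rewrite size_map.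
have inI t : a - r <= t <= a + r -> `|t - a| <= r.
  by move=> tI; rewrite ler_norml; lra.
have fZ t : a - r <= t <= a + r ->
    psum_derivn b a n.+1 t = \prod_(z <- Z) (t - z) * psum g (t - a).
  move=> /inI tr; rewrite /psum_derivn fg ?(le_lt_trans tr)//; congr (_ * _).
  by rewrite big_map; apply: eq_bigr => z _; ring.
have [|x [y [xyI xyP]]] := @interval_decomposition R (a - r) (a + r)
    (Z ++ midpoints Z) (2 * N + 2 * N * (2 * N)) ltac:(lra).
  by rewrite size_cat size_allpairs leq_add// leq_mul.
exists x, y; split; first exact: xyI.
move=> j Ij; have [xj yj Zj] := xyP j.
have xyj : x j < y j by case: xyI.
have IjI t : x j <= t <= y j -> a - r <= t <= a + r.
  by move=> /andP[xt ty]; rewrite (le_trans xj)//= (le_trans ty).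
have [p [e [e1 ep Zp pZ]]] := root_centre xyj Zj.
pose m := count_mem p Z.
pose P : {poly R} := \prod_(z <- Z | z != p) ('X - z%:P).
pose h t := P.[t] * psum_derivn g a 0 t.
pose D k t := psum_derivn b a k.+1 t.
have normI t : x j <= t <= y j -> `|t - a| < rho.
  by move=> /IjI/inI tr; exact: le_lt_trans rr.
have dD k t : x j <= t <= y j -> is_derive t 1 (D k) (D k.+1 t).
  by move=> /normI; exact: is_derive_psum_derivn.
have Dh t : x j <= t <= y j -> D n t = (t - p) ^+ m * h t.
  move=> /IjI/fZ; rewrite /D (prod_sub_split _ p) => ->.
  rewrite -mulrA; congr (_ * (_ * _)); rewrite /P horner_prod.
  by apply: eq_bigr => z _; rewrite hornerXsubC.
have hc : {within `[x j, y j], continuous h}.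
  apply: derivable_within_continuous => t; rewrite in_itv/= => /normI tr.
  have d1 : is_derive t 1 (psum_derivn g a 0) _ := is_derive_psum_derivn 0 gr tr.
  by apply: derivableM; [exact: derivable_horner|case: d1].
have hn t : x j <= t <= y j -> h t != 0.
  move=> tj; rewrite /h mulf_neq0//; last by apply/gn/inI/IjI.
  rewrite /P horner_prod prodf_seq_neq0; apply/allP => z zZ; apply/implyP => zp.
  rewrite hornerXsubC subr_eq0; apply: contraNneq zp => tz.
  by apply/eqP/(Zp _ zZ); rewrite -tz.
(* D is the sequence of derivatives of phi', so D n is phi^(d). *)
have [sgn [c [C [K [c0 C0 K0 bnd dd]]]]] := divdiff_ge_power_weight xyj e1 ep dD Dh hc hn.
have phidD t : x j <= t <= y j -> phid t = D n t by move=> /IjI; exact: phidE.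
split.
  case: sgn => sgn; [left|right] => t; rewrite /Ij/= in_itv/= => tj;
    by rewrite phidD// sgn.
exists c, C, K, p, m%:Z; split.
- by [].
- rewrite /Ij/= in_itv/= => pj; have [pxy pinZ] := pZ pj; split=> //.
  rewrite phidD// /D fZ ?IjI// (big_rem p)//= subrr !mul0r//.
- by rewrite lez_nat (leq_trans (count_size _ _)).
- move=> t; rewrite /Ij/= in_itv/= => tj; rewrite phidD//.
  by have /andP[] := bnd t tj.
move=> t tj.
have tJ l : x j <= t 0 l <= y j by have := tj l; rewrite /Ij/= in_itv.
(* If two of the points coincide, the product of differences is zero. *)
have [tinj|tninj] := pselect (injective (t 0)); last first.
  have [l [l' [ll' tll']]] : exists l l' : 'I_n.+1, (l < l')%N /\ t 0 l = t 0 l'.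
    apply: contrapT => nex; apply: tninj => l l' tll'.
    case: (ltngtP l l') => [lt|gt|/val_inj//]; exfalso; apply: nex.
      by exists l, l'; split.
    by exists l', l; split.
  rewrite (_ : \prod_(l < n.+1) \prod_(m < n.+1 | _) _ = 0) ?mulr0//.
  by rewrite (bigD1 l)//= (bigD1 l')//= tll' subrr normr0 !mul0r.
apply: le_trans (jacobian_det_ge hr rr br phib (fun l => IjI _ (tJ l)) tinj).
rewrite mulrA ler_wpM2r//.
  by apply: prodr_ge0 => i _; apply: prodr_ge0.
apply: prod_powR_le => // l; rewrite phidD//.
apply: dd.
- by rewrite size_map size_enum_ord.
- by rewrite map_inj_uniq// enum_uniq.
- by move=> u /mapP[i _ ->].
- by apply/mapP; exists l => //; rewrite mem_enum.
Qed.
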